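(* Let $A_n=\frac{1}{\sqrt n}(a_{ij})_{i,j=1}^n$ be a matrix from the Gaussian Orthogonal Ensemble, i.e. a real symmetric $n\times n$ matrix with $\{a_{ij}=a_{ji}\}_{i\le j}$ independent $N(0,1+\delta_{ij})$ random variables. For $z\in\mathbb{C}$ with $\Im z\neq 0$ set $G_n(z)=(A_n-2-z n^{-2/3})^{-1}$ (where $A_n-w$ means $A_n-w\,\mathrm{Id}$), $g_{n,k}(z)=n^{-2k/3}\,\mathrm{Tr}\,G_n^k(z)$ for integers $k\ge 2$, and $g^c_{n,1}(z)=n^{-2/3}\left(n+\mathrm{Tr}\,G_n(z)\right)$. For a multi-index $K=(k_1,\dots,k_j)$, $j\ge1$, of nonnegative integers, let $$m_K=\mathbb{E}\Big((g^c_{n,1}(z))^{k_1}\prod_{l=2}^j (g_{n,l}(z))^{k_l}\Big),$$ and let $e_l$ denote the multi-index whose $l$-th component is $1$ and all other components are $0$. Then for every non-zero multi-index $K$, $$m_K\,(z+O(n^{-2/3}))-m_{K+2e_1}(1+O(n^{-2/3}))-m_{K+e_2}(1+O(n^{-2/3}))-2\sum_{l\ge1} l\,k_l\, m_{K-e_l+e_{l+2}}(1+O(n^{-2/3}))=O(n^{-1/3})\,m_{K+e_1},$$ where the term $k_l\, m_{K-e_l+e_{l+2}}$ is interpreted as $0$ when $k_l=0$. Moreover, the following boundary condition holds: $$z+O(n^{-2/3})-m_{2e_1}(1+O(n^{-2/3}))-m_{e_2}(1+O(n^{-2/3}))=O(n^{-1/3})\,m_{e_1}.$$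
   Context: Multi-indices are added componentwise, extending by zero components as needed (a component beyond the length of a multi-index is $0$, i.e. the corresponding factor is absent from $m_K$). The symbols $O(n^{-a})$ denote (possibly different) quantities, as $n\to\infty$, bounded in absolute value by a constant times $n^{-a}$. *)

(* Defs.v *)
From HB Require Import structures.
From mathcomp Require Import all_boot all_order all_algebra.
From mathcomp Require Import all_classical all_reals all_analysis.
From mathcomp Require Import complex.

Set Implicit Arguments.
Unset Strict Implicit.
Unset Printing Implicit Defensive.

Import Order.TTheory GRing.Theory Num.Theory.
Local Open Scope classical_set_scope.
Local Open Scope ring_scope.

(* Multi-indices K = (k_1, ..., k_j) are sequences of naturals; the    *)
(* component l (l >= 1) is the (l-1)-th entry, and is 0 beyond size.   *)

Definition mcomp (K : seq nat) (l : nat) : nat := nth 0%N K l.-1.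

Definition madd (K L : seq nat) : seq nat :=
  mkseq (fun i => (nth 0%N K i + nth 0%N L i)%N) (maxn (size K) (size L)).

(* componentwise (truncated) difference; only used as K - e_l with k_l >= 1 *)
Definition msub (K L : seq nat) : seq nat :=
  mkseq (fun i => (nth 0%N K i - nth 0%N L i)%N) (maxn (size K) (size L)).

Definition unitmi (l : nat) : seq nat := rcons (nseq l.-1 0%N) 1%N.

Definition mi_nonzero (K : seq nat) : bool := has (fun k => k != 0%N) K.

(* GOE entries: a family a i j (i, j : nat) of real random variables,  *)
(* symmetric, with {a i j}_{i <= j} mutually independent and           *)
(* a i j ~ N(0, 1 + delta_ij) (normal_prob takes the standard dev.).   *)
(* One infinite family realises the GOE matrix for every n at once     *)
(* (A_n uses the top-left n x n block).                                *)

Definition GOE_family d (T : measurableType d) (R : realType)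
  (P : probability T R) (a : nat -> nat -> {RV P >-> R}) : Prop :=
  [/\ (forall i j w, a i j w = a j i w),
      (forall i j (B : set R), measurable B ->
         distribution P (a i j) B
         = normal_prob 0 (Num.sqrt (1 + (i == j)%:R)) B) &
      (forall (s : seq (nat * nat)), uniq s -> all (fun p => p.1 <= p.2)%N s ->
       forall B : nat * nat -> set R, (forall p, measurable (B p)) ->
         P (\big[setI/setT]_(p <- s) (a p.1 p.2 @^-1` B p))
         = (\prod_(p <- s) P (a p.1 p.2 @^-1` B p))%E)].

Definition cexpect d (T : measurableType d) (R : realType)
  (P : probability T R) (f : T -> R[i]) : R[i] :=
  Complex (fine ('E_P[fun w => complex.Re (f w)])%E)
          (fine ('E_P[fun w => complex.Im (f w)])%E).

Definition npowC (R : realType) (n : nat) (r : R) : R[i] :=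
  real_complex R ((n%:R : R) `^ r).

Section GOE.
Context d (T : measurableType d) (R : realType) (P : probability T R).
Variable a : nat -> nat -> {RV P >-> R}.

Definition GOEmx (n : nat) (w : T) : 'M[R]_n :=
  \matrix_(i < n, j < n) (a i j w / Num.sqrt (n%:R)).

Definition resolv (n : nat) (z : R[i]) (w : T) : 'M[R[i]]_n :=
  invmx (map_mx (real_complex R) (GOEmx n w)
         - (2%:R + z * npowC n (- (2 / 3))) %:M).

Definition gnl (n : nat) (z : R[i]) (l : nat) (w : T) : R[i] :=
  if l == 1%N then npowC n (- (2 / 3)) * (n%:R + \tr (resolv n z w))
  else npowC n (- (2 * l%:R / 3)) * \tr (resolv n z w ^+ l).

Definition mK (n : nat) (z : R[i]) (K : seq nat) : R[i] :=
  cexpect P (fun w => \prod_(i < size K) gnl n z i.+1 w ^+ nth 0%N K i).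

End GOE.

Definition bigO_pow (R : realType) (c : nat -> R[i]) (r : R) : Prop :=
  exists C : R, exists N : nat, forall n : nat, (N <= n)%N ->
    `|c n| <= real_complex R (C * (n%:R : R) `^ r).

(* Main.v *)
(* The matrix G inverts A - w with w = 2 + z n^{-2/3}, so that
   tr (A G) = n + w tr G.  Multiply by a monomial F in the g's, take the
   expectation and integrate by parts in each Gaussian entry a_ij (Stein's
   lemma): since d G / d a_ij is - n^{-1/2} G (E_ij + E_ji) G, up to the factor
   1 + delta_ij that the variance of a_ij supplies, the left-hand side becomes
   - 1/n E [(tr G^2 + (tr G)^2) F + 2 sum_l l tr G^{l+2} dF / d(tr G^l)].
   After rescaling, the terms of order n^{2/3} and n cancel and the resulting
   identity is exact: every O(n^{-2/3}) can be taken to be 0 and O(n^{-1/3}) to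
   be z n^{-1/3}.  All integrations by parts are legitimate because the
   resolvent of a real symmetric matrix is bounded by a multiple of
   1 / |Im w|, uniformly in the matrix. *)
Require Import Defs.
From HB Require Import structures.
From mathcomp Require Import all_boot all_order all_algebra.
From mathcomp Require Import all_classical all_reals all_analysis.
From mathcomp Require Import measurable_realfun complex ring zify.
Import Order.TTheory GRing.Theory Num.Theory.
Import numFieldTopology.Exports numFieldNormedType.Exports.
Set Implicit Arguments.
Unset Strict Implicit.
Unset Printing Implicit Defensive.
Local Open Scope classical_set_scope.
Local Open Scope ring_scope.
Local Open Scope complex_scope.

(** * Stein's lemma in one variable *)

(** The centring at 2 and the scale n^{-2/3} are what make the rescaled identity exact. Put v =
    n^{-1/3}, so that n v^3 = 1 and w = 2 + z v^2, and let t = tr G. Under the expectation against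
    F, integration by parts evaluates n (n + w t); moving t^2 to the same side gives n^2 + n w t +
    t^2 = (n + t)^2 + n z v^2 t, so the 2 completes a square. Multiplied by v^4, the square is the
    square of g^c_1 = v^2 (n + t), and the rest is z v^3 t = z v g^c_1 - z, which yields both z m_K
    and the right-hand side. The obstacle is to integrate by parts in one entry while all the others
    stay random. The others are never turned into coordinates: the sample space, with the smaller
    sigma-algebra that they generate, is the second factor of a product, and Fubini leaves a
    Gaussian integral on the line. Differentiability is replaced by a uniform bound on the quadratic
    Taylor remainder. The resolvent identity provides it directly, and it gives continuity,
    derivative and domination together. *)

Section normal.
Context (R : realType) (s : R).
Hypothesis s0 : 0 < s.
Local Notation mu := (@lebesgue_measure R).
Local Notation N := (normal_prob 0 s).
Local Notation pdf := (normal_pdf 0 s).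

(** Both functions integrate to [N E] over every measurable [E], hence agree almost everywhere. This
    turns change of variables, stated with a Radon-Nikodym derivative, into a formula with the
    explicit density. *)
Lemma ae_eq_normal_pdf :
  ae_eq mu setT (Radon_Nikodym_SigmaFinite.f N mu) (EFin \o pdf).
Proof.
have dom := normal_prob_dominates 0 s.
apply: integral_ae_eq => //.
- exact: Radon_Nikodym_SigmaFinite.f_integrable.
- exact: measurable_int (integrable_normal_pdf 0 s).
- by move=> E _ mE; rewrite -Radon_Nikodym_SigmaFinite.f_integral.
Qed.

Lemma ge0_integral_normal_prob (f : R -> \bar R) :
  (forall x, 0 <= f x)%E -> measurable_fun [set: R] f ->
  (\int[N]_x f x = \int[mu]_x (f x * (pdf x)%:E))%E.
Proof.
move=> f0 mf.
have dom := normal_prob_dominates 0 s.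
rewrite -(Radon_Nikodym_SigmaFinite.change_of_variables dom)//.
apply: ae_eq_integral => //.
- apply: emeasurable_funM => //.
  exact: measurable_int (Radon_Nikodym_SigmaFinite.f_integrable dom).
- apply: emeasurable_funM => //.
  exact: measurable_int (integrable_normal_pdf 0 s).
- exact/ae_eqe_mul2l/ae_eq_normal_pdf.
Qed.

Lemma integral_normal_prob (f : R -> \bar R) : N.-integrable setT f ->
  (\int[N]_x f x = \int[mu]_x (f x * (pdf x)%:E))%E.
Proof.
move=> intf.
have dom := normal_prob_dominates 0 s.
have mf := measurable_int _ intf.
rewrite -(Radon_Nikodym_change_of_variables dom)//.
apply: ae_eq_integral => //.
- exact: emeasurable_funM.
- apply: emeasurable_funM => //.
  exact: measurable_int (integrable_normal_pdf 0 s).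
- apply: ae_eqe_mul2l; apply: ae_eq_trans ae_eq_normal_pdf.
  exact/ae_eq_sym/ae_eq_Radon_Nikodym_SigmaFinite.
Qed.

(** Half of the Gaussian exponent absorbs the linear factor: [|x|] <= s (1 + x^2 / (4 s^2)) by
    completing a square, and 1 + t <= exp t. What remains is a Gaussian of variance 2 s^2. The same
    bound serves for integrability and for decay at infinity. *)
Lemma normal_pdf_first_moment (x : R) :
  `|x| * pdf x <=
  s * normal_peak s / normal_peak (Num.sqrt 2 * s) * normal_pdf 0 (Num.sqrt 2 * s) x.
Proof.
have s20 : 0 < Num.sqrt 2 * s by rewrite mulr_gt0.
rewrite !normal_pdfE ?gt_eqF//.
rewrite -[leRHS]mulrA mulKf; last by rewrite gt_eqF ?normal_peak_gt0 ?gt_eqF.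
rewrite mulrCA -[leRHS]mulrA [leRHS]mulrCA ler_wpM2l ?normal_peak_ge0//.
have -> : normal_fun 0 s x =
    normal_fun 0 (Num.sqrt 2 * s) x * expR (- (x ^+ 2 / (s ^+ 2 *+ 4))).
  rewrite /normal_fun -expRD subr0 exprMn sqr_sqrtr//; congr expR.
  by field; rewrite gt_eqF.
rewrite mulrCA [leRHS]mulrC ler_wpM2l ?normal_fun_ge0//.
rewrite expRN ler_pdivrMr ?expR_gt0//.
apply: (@le_trans _ _ (s * (1 + x ^+ 2 / (s ^+ 2 *+ 4)))); last first.
  by rewrite ler_pM2l// expR_ge1Dx.
rewrite -subr_ge0.
have -> : s * (1 + x ^+ 2 / (s ^+ 2 *+ 4)) - `|x| =
   s * (1 - `|x| / (s *+ 2)) ^+ 2.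
  by rewrite -(real_normK (num_real x)); field; rewrite gt_eqF.
by rewrite mulr_ge0 ?sqr_ge0// ltW.
Qed.

(** Linear growth is allowed because the integrand [x * f x] of Stein's lemma has it. The dominating
    function is a combination of two Gaussian densities, by the bound on the first moment. *)
Lemma integrable_normal_pdfM (f : R -> R) C : measurable_fun [set: R] f ->
  (forall x, `|f x| <= C * (1 + `|x|)) ->
  mu.-integrable setT (fun x => (f x * pdf x)%:E).
Proof.
move=> mf fC.
pose c := s * normal_peak s / normal_peak (Num.sqrt 2 * s).
pose q := normal_pdf 0 (Num.sqrt 2 * s).
have ig : mu.-integrable setT (EFin \o (fun x => C * (pdf x + c * q x))).
  have -> : EFin \o (fun x => C * (pdf x + c * q x)) =
      (fun x => C%:E * (EFin \o pdf \+ (fun x => c%:E * (EFin \o q) x)) x)%E.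
    by apply/funext => x/=; rewrite EFinM EFinD EFinM.
  apply: integrableZl => //; apply: integrableD => //.
    exact: integrable_normal_pdf.
  by apply: integrableZl => //; exact: integrable_normal_pdf.
apply: le_integrable ig => //.
- by apply/measurable_EFinP/measurable_funM => //; exact: measurable_normal_pdf.
- move=> x _ /=; rewrite lee_fin.
  rewrite normrM (ger0_norm (normal_pdf_ge0 _ _ _)).
  apply: le_trans (ler_norm _).
  apply: (@le_trans _ _ (C * (1 + `|x|) * pdf x)).
    by rewrite ler_wpM2r ?normal_pdf_ge0.
  rewrite -mulrA ler_wpM2l//.
    by have := le_trans (normr_ge0 _) (fC 0); rewrite normr0 addr0 mulr1.
  by rewrite mulrDl mul1r lerD2l normal_pdf_first_moment.
Qed.

Lemma integrable_normal_prob (f : R -> R) C : measurable_fun [set: R] f ->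
  (forall x, `|f x| <= C * (1 + `|x|)) -> N.-integrable setT (EFin \o f).
Proof.
move=> mf fC; apply/integrableP; split; first exact/measurable_EFinP.
rewrite ge0_integral_normal_prob//; last first.
  by apply: measurableT_comp => //; exact/measurable_EFinP.
have /integrableP[_] := integrable_normal_pdfM mf fC.
under eq_integral do rewrite EFinM abseM.
by under eq_integral do rewrite [X in (_ * X)%E]gee0_abs ?lee_fin ?normal_pdf_ge0//.
Qed.

Lemma is_derive_normal_pdf (x : R) :
  is_derive x (1 : R) pdf (- (x / s ^+ 2) * pdf x).
Proof.
rewrite normal_pdfE ?gt_eqF//.
have dg : is_derive x (1 : R) (fun y : R => - (y - 0) ^+ 2 / (s ^+ 2 *+ 2))
    (- (x / s ^+ 2)).
  apply: is_derive_eq; rewrite /GRing.scale/=.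
  by field; rewrite gt_eqF.
have de := is_derive1_comp (is_derive_expR _) dg.
apply: is_derive_eq; rewrite /GRing.scale/= /normal_fun.
by field; rewrite gt_eqF.
Qed.

End normal.

(** * Functions with a uniform quadratic Taylor remainder *)

Section quadratic.
Context (R : realType) (f f' : R -> R) (C : R).
Hypothesis fC : forall x y, [/\ `|f x| <= C, `|f' x| <= C,
  `|f y - f x| <= C * `|y - x| & `|f y - f x - (y - x) * f' x| <= C * (y - x) ^+ 2].

Lemma lipschitz_continuous (g : R -> R) (K : R) :
  (forall x y, `|g y - g x| <= K * `|y - x|) -> continuous g.
Proof.
move=> gK x; apply/cvgrPdist_le => /= e e0.
have K0 : 0 < `|K| + 1 by rewrite ltr_pwDr.
near=> y; rewrite distrC (le_trans (gK x y))//.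
apply: (@le_trans _ _ ((`|K| + 1) * `|y - x|)).
  by rewrite ler_wpM2r// ler_wpDr// ler_norm.
rewrite -ler_pdivlMl// mulrC distrC; near: y.
exists (e / (`|K| + 1)) => /=; first by rewrite divr_gt0.
by move=> z /= /ltW.
Unshelve. all: by end_near. Qed.

Lemma quadratic_continuous : continuous f.
Proof. by apply: (@lipschitz_continuous _ C) => x y; have [] := fC x y. Qed.

(** Adding the Taylor remainders taken at [x] and at [y] cancels the values of [f] and leaves (y -
    x)(f' y - f' x), so [f'] is Lipschitz with constant 2C. *)
Lemma quadratic_continuous_deriv : continuous f'.
Proof.
apply: (@lipschitz_continuous _ (C + C)) => x y.
have [->|yx] := eqVneq y x; first by rewrite !subrr normr0 mulr0.
have [_ _ _ h1] := fC x y; have [_ _ _ h2] := fC y x.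
have yx0 : 0 < `|y - x| by rewrite normr_gt0 subr_eq0.
rewrite -(ler_pM2l yx0) -normrM.
have -> : (y - x) * (f' y - f' x) =
  (f y - f x - (y - x) * f' x) + (f x - f y - (x - y) * f' y) by ring.
rewrite (le_trans (ler_normD _ _))// (le_trans (lerD h1 h2))//.
have -> : (x - y) ^+ 2 = (y - x) ^+ 2 by ring.
rewrite -(real_normK (num_real (y - x))).
by rewrite le_eqVlt; apply/orP; left; apply/eqP; ring.
Qed.

Lemma quadratic_is_derive (x : R) : is_derive x (1 : R) f (f' x).
Proof.
have fx : h^-1 *: (f (h *: 1 + x) - f x) @[h --> (0:R)^'] --> f' x.
  apply/cvgrPdist_le => /= e e0.
  have C0 : 0 < `|C| + 1 by rewrite ltr_pwDr.
  near=> h.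
  have h0 : h != 0 by near: h; exact: nbhs_dnbhs_neq.
  have [_ _ _ h1] := fC x (h + x).
  rewrite distrC /GRing.scale/= mulr1.
  have nh0 : 0 < `|h| by rewrite normr_gt0.
  rewrite -(ler_pM2l nh0) -normrM mulrBr mulVKf//.
  move: h1; rewrite addrK => /le_trans; apply.
  rewrite -(real_normK (num_real h)) expr2 mulrCA ler_pM2l//.
  apply: (@le_trans _ _ ((`|C| + 1) * `|h|)).
    by rewrite ler_wpM2r// ler_wpDr// ler_norm.
  rewrite -ler_pdivlMl// mulrC; near: h.
  by apply: dnbhs0_le; rewrite divr_gt0.
have df : derivable f x 1 by apply/cvg_ex; exists (f' x).
by apply: DeriveDef => //; apply/cvg_lim.
Unshelve. all: by end_near. Qed.

End quadratic.

(** * Integration by parts against the Gaussian density *)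

Section stein.
Context (R : realType) (s : R) (f f' : R -> R) (C : R).
Hypothesis s0 : 0 < s.
Hypothesis fC : forall x y, [/\ `|f x| <= C, `|f' x| <= C,
  `|f y - f x| <= C * `|y - x| & `|f y - f x - (y - x) * f' x| <= C * (y - x) ^+ 2].
Local Notation mu := (@lebesgue_measure R).
Local Notation N := (normal_prob 0 s).
Local Notation pdf := (normal_pdf 0 s).

(** The derivative of [h] is [u * pdf], since pdf' = - (x / s^2) pdf. Stein's lemma is therefore the
    vanishing of the integral of [u * pdf]. *)
Let h x := f x * pdf x.
Let u x := f' x - x / s ^+ 2 * f x.

Let C0 : 0 <= C.
Proof. by have [h0 _ _ _] := fC 0 0; exact: le_trans (normr_ge0 _) h0. Qed.

Let mf : measurable_fun [set: R] f.
Proof. apply: continuous_measurable_fun; exact: (quadratic_continuous fC). Qed.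

Let mf' : measurable_fun [set: R] f'.
Proof. apply: continuous_measurable_fun; exact: (quadratic_continuous_deriv fC). Qed.

Let measurable_u : measurable_fun [set: R] u.
Proof.
apply: measurable_funB => //; apply: measurable_funM => //.
exact: measurable_funM.
Qed.

Let fb x : `|f x| <= C. Proof. by have [] := fC x x. Qed.
Let fb' x : `|f' x| <= C. Proof. by have [] := fC x x. Qed.

Let xfb x : `|x * f x| <= C * (1 + `|x|).
Proof.
rewrite normrM mulrC (le_trans (ler_wpM2r (normr_ge0 _) (fb x)))// ler_wpM2l//.
by rewrite lerDr ler01.
Qed.

Let fb1' x : `|f' x| <= C * (1 + `|x|).
Proof. by rewrite (le_trans (fb' x))// ler_peMr// lerDl. Qed.

Let ub x : `|u x| <= (C + C / s ^+ 2) * (1 + `|x|).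
Proof.
rewrite (le_trans (ler_normB _ _))// mulrDl lerD//.
rewrite mulrAC normrM [_ / _ * _]mulrAC ler_pM// ger0_norm//.
by rewrite invr_ge0 sqr_ge0.
Qed.

Let iupdf : mu.-integrable setT (fun x => (u x * pdf x)%:E).
Proof. exact: integrable_normal_pdfM measurable_u ub. Qed.

Let is_derive_h (x : R) : is_derive x (1 : R) h (u x * pdf x).
Proof.
have d1 := quadratic_is_derive fC x.
have d2 := is_derive_normal_pdf s0 x.
apply: is_derive_eq; rewrite /GRing.scale/= /u; ring.
Qed.

Let continuous_updf : continuous (fun x : R => u x * pdf x).
Proof.
move=> x; apply: cvgM; last by apply: continuous_normal_pdf; rewrite gt_eqF.
apply: cvgB; first exact: (quadratic_continuous_deriv fC).
apply: cvgM; last exact: (quadratic_continuous fC).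
by apply: cvgM; [exact: cvg_id|exact: cvg_cst].
Qed.

(** The bound [n.+1] keeps the interval nondegenerate, as the fundamental theorem of calculus
    requires, and matches the harmonic sequence that controls the boundary terms. *)
Let integral_itv (n : nat) :
  (\int[mu]_(x in `[(- n.+1%:R)%R, n.+1%:R%R]) (u x * pdf x)%:E =
   (h n.+1%:R - h (- n.+1%:R))%:E)%E.
Proof.
have nn : (- n.+1%:R : R) < n.+1%:R by rewrite -subr_gt0 opprK addr_gt0.
have ch : continuous h.
  by move=> x; apply/differentiable_continuous/derivable1_diffP; have [] := is_derive_h x.
rewrite (@continuous_FTC2 _ _ h) ?EFinB//.
- exact: continuous_subspaceT.
- split.
  + by move=> x _; have [] := is_derive_h x.
  + by apply: cvg_at_right_filter; exact: ch.
  + by apply: cvg_at_left_filter; exact: ch.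
- by move=> x _; rewrite derive1E; have dh := is_derive_h x; rewrite derive_val.
Qed.

Let hb (n : nat) (x : R) : `|x| = n.+1%:R ->
  `|h x| <= C * (s * normal_peak s) * n.+1%:R^-1.
Proof.
move=> xn; rewrite normrM (ger0_norm (normal_pdf_ge0 _ _ _)) -mulrA ler_pM//.
  exact: normal_pdf_ge0.
rewrite ler_pdivlMr// mulrC -xn.
have s20 : 0 < Num.sqrt 2 * s by rewrite mulr_gt0.
apply: le_trans (normal_pdf_first_moment s0 x) _.
rewrite -mulrA ler_piMr// ?mulr_ge0 ?normal_peak_ge0// ?(ltW s0)//.
by rewrite ler_pdivrMl ?mulr1 ?normal_pdf_ub ?normal_peak_gt0 ?gt_eqF.
Qed.

(** The integrals over the growing intervals converge to the full integral by dominated convergence,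
    and they equal boundary terms of order 1/(n + 1). *)
Let integral0 : (\int[mu]_x (u x * pdf x)%:E = 0)%E.
Proof.
pose A n : set R := `[- n.+1%:R, n.+1%:R]%classic.
pose g n := (fun x => (u x * pdf x)%:E) \_ (A n).
have [| | | | |_ _ gl] := @dominated_convergence _ _ _ mu setT measurableT g
  (fun x => (u x * pdf x)%:E) (fun x => `|(u x * pdf x)%:E|)%E.
- move=> n; apply/measurable_restrict => //; first exact: measurable_itv.
  apply: measurable_funTS.
  exact: measurable_int iupdf.
- exact: measurable_int iupdf.
- apply: aeW => x _; apply: cvg_near_cst.
  near=> n; rewrite /g patchE mem_set// /A/= in_itv/= -ler_norml.
  near: n; exists (Num.truncn `|x|) => // n /= xn.
  by rewrite (le_trans (ltW (truncnS_gt _)))// ler_nat ltnS.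
- exact: integrable_abse.
- apply: aeW => x n _; rewrite /g patchE; case: ifP => //.
  by rewrite abse0.
apply: cvg_unique gl _ => //.
apply: (@squeeze_cvge _ _ _ _
   (fun n => (- (2 * (C * (s * normal_peak s)) * n.+1%:R^-1))%:E) _
   (fun n => (2 * (C * (s * normal_peak s)) * n.+1%:R^-1)%:E)).
- apply: nearW => n /=; rewrite /g -integral_mkcond integral_itv !lee_fin -ler_norml.
  rewrite (le_trans (ler_normB _ _))// -mulrA mulr_natl mulr2n.
  by rewrite lerD ?hb// ?normrN ger0_norm.
- apply: cvg_EFin; first by apply: nearW.
  rewrite -oppr0; apply: cvgN; rewrite -(mulr0 (2 * (C * (s * normal_peak s)))).
  by apply: cvgMr; exact: cvg_harmonic.
- apply: cvg_EFin; first by apply: nearW.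
  rewrite -(mulr0 (2 * (C * (s * normal_peak s)))).
  by apply: cvgMr; exact: cvg_harmonic.
Unshelve. all: by end_near. Qed.

Lemma normal_stein :
  (\int[N]_x (x * f x)%:E = (s ^+ 2)%:E * \int[N]_x (f' x)%:E)%E.
Proof.
have mxf : measurable_fun [set: R] (fun x => x * f x) by exact: measurable_funM.
have ixf := integrable_normal_prob s0 mxf xfb.
have if' := integrable_normal_prob s0 mf' fb1'.
rewrite (integral_normal_prob ixf) (integral_normal_prob if').
have ixfp := integrable_normal_pdfM s0 mxf xfb.
have ifp' := integrable_normal_pdfM s0 mf' fb1'.
under eq_integral do rewrite /= -EFinM.
under [X in (_ * X)%E]eq_integral do rewrite /= -EFinM.
have -> : (\int[mu]_x (x * f x * pdf x)%:E =
  \int[mu]_x ((s ^+ 2)%:E * (f' x * pdf x)%:E - (s ^+ 2)%:E * (u x * pdf x)%:E))%E.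
  apply: eq_integral => x _; rewrite -!EFinM -EFinB /u; congr EFin.
  by field; rewrite gt_eqF.
rewrite integralB//; [|exact: integrableZl|exact: integrableZl].
by rewrite !integralZl// integral0 mule0 sube0.
Qed.
End stein.

(** * Integration by parts in one of several independent variables *)

Section normal_on_R.
Context (R : realType) (s : R).

Definition idTR : measurableTypeR R -> R := idfun.

#[local] HB.instance Definition _ :=
  @isMeasurableFun.Build _ _ _ _ idTR (@measurable_id _ _ setT).

(* [normal_prob] lives on [measurableTypeR R], whose measurable structure is
   not convertible to the canonical one on [R]. *)
Definition normal_law := distribution (normal_prob 0 s) idTR.

#[local] HB.instance Definition _ := Probability.on normal_law.

Lemma ge0_integral_normal_law (f : R -> \bar R) : measurable_fun [set: R] f ->
  (forall x, 0 <= f x)%E -> (\int[normal_law]_x f x = \int[normal_prob 0 s]_x f x)%E.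
Proof. exact: (@ge0_integral_distribution _ _ _ _ _ (normal_prob 0 s) idTR). Qed.

Lemma integral_normal_law (f : R -> \bar R) :
  (normal_prob 0 s).-integrable setT f ->
  (\int[normal_law]_x f x = \int[normal_prob 0 s]_x f x)%E.
Proof.
move=> intf; apply: (@integral_distribution _ _ _ _ _ (normal_prob 0 s) idTR) => //.
exact: measurable_int intf.
Qed.
End normal_on_R.

Section indep.
Context d (T : measurableType d) (R : realType) (P : probability T R).
Variables (X : {RV P >-> R}) (s : R) (G : set (set T)).
Hypothesis s0 : 0 < s.
Hypothesis lawX : forall B : set R, measurable B ->
  distribution P X B = normal_prob 0 s B.
Hypothesis Gm : G `<=` measurable.
Hypothesis GI : setI_closed G.
Hypothesis GT : G setT.
Hypothesis indep : forall (B : set R) A, measurable B -> G A ->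
  P (X @^-1` B `&` A) = (P (X @^-1` B) * P A)%E.

Local Notation T' := (g_sigma_algebraType G).
Local Notation N := (normal_law s).

Lemma integral_normal_RV (f : R -> \bar R) : measurable_fun [set: R] f ->
  (forall x, 0 <= f x)%E -> (\int[P]_w f (X w) = \int[N]_x f x)%E.
Proof.
move=> mf f0; rewrite -(ge0_integral_distribution X mf f0).
by apply: eq_measure_integral => A mA _; exact: lawX.
Qed.

Lemma integrable_normal_RV : P.-integrable setT (EFin \o X).
Proof.
apply/integrableP; split; first exact/measurable_EFinP.
under eq_integral do rewrite /=.
have mn : measurable_fun [set: R] (fun x => `|x%:E|)%E.
  by apply: measurableT_comp => //; exact/measurable_EFinP.
rewrite (integral_normal_RV mn)// ge0_integral_normal_law//.
have xx (x : R) : `|x| <= 1 * (1 + `|x|) by rewrite mul1r lerDr.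
by have /integrableP[] := integrable_normal_prob s0 (@measurable_id _ R setT) xx.
Qed.

Let mid : measurable_fun [set: T] (idfun : T -> T').
Proof.
move=> _ B mB; rewrite setTI preimage_id.
exact: (smallest_sub (@sigma_algebra_measurable _ T) Gm).
Qed.

(** The second coordinate is the sample point itself, seen through the coarser sigma-algebra
    generated by [G]. Independence of [X] from [G] makes the law of [phi] a product measure although
    the pair is a function of one point. *)
Let phi (w : T) : R * T' := (X w, w).

Lemma measurable_indep_pair : measurable_fun [set: T] phi.
Proof. exact: measurable_fun_pair. Qed.

#[local] HB.instance Definition _ := isMeasurableFun.Build _ _ _ _ (idfun : T -> T') mid.
#[local] HB.instance Definition _ := isMeasurableFun.Build _ _ _ _ phi measurable_indep_pair.

Let Q := distribution P (idfun : T -> T').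

(** For fixed [B], both sides are finite measures in [A] that agree on the pi-system [G], hence on
    the sigma-algebra it generates. The finite number [P XB] is packed as a nonnegative real so that
    it can scale a measure. *)
Let indepG (B : set R) (A : set T') : measurable B -> measurable A ->
  P (X @^-1` B `&` A) = (N B * Q A)%E.
Proof.
move=> mB mA; set XB := X @^-1` B.
have mXB : measurable XB by rewrite -[XB]setTI; exact: measurable_funP.
have PXB : P XB = N B by exact: lawX.
pose r := NngNum (fine_ge0 (measure_ge0 P XB)).
rewrite setIC -PXB -[P XB]fineK ?fin_num_measure//.
apply: (@g_sigma_algebra_measure_unique _ _ _ G Gm (fun=> setT) _ _
  (mrestr P mXB) (mscale r P)) => //.
- by rewrite bigcup_const.
- by move=> A' GA'; rewrite /= /mrestr/= /mscale/= setIC fineK ?fin_num_measure ?indep.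
- by move=> _; rewrite /= /mrestr setTI -ge0_fin_numE// fin_num_measure.
Qed.

Let law_phi (A : set (R * T')) : measurable A ->
  (N \x Q)%E A = distribution P phi A.
Proof.
apply: product_measure_unique => B A' mB mA'.
by rewrite -indepG.
Qed.

Variables (f f' : R * T' -> R) (C : R).
Hypothesis mf : measurable_fun setT f.
Hypothesis mf' : measurable_fun setT f'.
Hypothesis fC : forall x y w, [/\ `|f (x, w)| <= C, `|f' (x, w)| <= C,
  `|f (y, w) - f (x, w)| <= C * `|y - x| &
  `|f (y, w) - f (x, w) - (y - x) * f' (x, w)| <= C * (y - x) ^+ 2].

Let C0 : 0 <= C.
Proof. by have [h0 _ _ _] := fC 0 0 point; exact: le_trans (normr_ge0 _) h0. Qed.

Let integrable_phi (h : R * T' -> R) K : measurable_fun setT h ->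
  (forall p, `|h p| <= K * (1 + `|p.1|)) ->
  P.-integrable [set: T] (fun w => (h (phi w))%:E).
Proof.
move=> mh hK.
apply: (@le_integrable _ _ _ P setT measurableT _ (fun w => (K * (1 + `|X w|))%:E)).
- by apply/measurable_EFinP; exact: (measurableT_comp mh measurable_indep_pair).
- by move=> w _; rewrite !abse_EFin lee_fin (le_trans (hK _))// ler_norm.
- rewrite (_ : (fun _ => _) =
      (fun w => K%:E * ((cst 1 \+ abse \o (EFin \o X)) w))%E); last first.
    by apply/funext => w/=; rewrite EFinM.
  apply: integrableZl => //; apply: integrableD => //.
    exact: finite_measure_integrable_cst.
  exact: integrable_abse integrable_normal_RV.
Qed.

Let integral_phi (h : R * T' -> R) K : measurable_fun setT h ->
  (forall p, `|h p| <= K * (1 + `|p.1|)) ->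
  (\int[P]_w (h (X w, w))%:E = \int[Q]_w \int[N]_x (h (x, w))%:E)%E.
Proof.
move=> mh hK; have ihP := integrable_phi mh hK.
have mEh : measurable_fun setT (EFin \o h) by exact/measurable_EFinP.
have ih : (N \x Q)%E.-integrable setT (EFin \o h).
  apply/integrableP; split => //.
  rewrite (eq_measure_integral (distribution P phi)); last first.
    by move=> A mA _; exact: law_phi.
  have /integrableP[_] := ihP.
  rewrite ge0_integral_distribution//.
  exact: measurableT_comp.
transitivity (\int[distribution P phi]_p (h p)%:E)%E.
  by rewrite (@integral_distribution _ _ _ _ _ P phi _ mEh).
rewrite -(eq_measure_integral (distribution P phi) (fun A mA _ => law_phi mA)).
by rewrite -integral21_prod_meas1.
Qed.

(** Fubini puts the Gaussian variable innermost, and for each fixed [w] the inner identity is the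
    one-variable lemma. The factor s^2 is first moved under the integral so that the two double
    integrals can be compared pointwise in [w]. *)
Lemma indep_stein :
  (\int[P]_w (X w * f (X w, w))%:E = (s ^+ 2)%:E * \int[P]_w (f' (X w, w))%:E)%E.
Proof.
have mxf : measurable_fun setT (fun p : R * T' => p.1 * f p).
  by apply: measurable_funM => //; exact: measurable_fst.
have xfC p : `|p.1 * f p| <= C * (1 + `|p.1|).
  case: p => x w /=; rewrite normrM mulrC.
  have [fx _ _ _] := fC x x w.
  by rewrite (le_trans (ler_wpM2r (normr_ge0 _) fx))// ler_wpM2l// lerDr ler01.
have f'C p : `|f' p| <= C * (1 + `|p.1|).
  case: p => x w /=; have [_ fx _ _] := fC x x w.
  by rewrite (le_trans fx)// ler_peMr// lerDl.
have ms2f' : measurable_fun setT (fun p : R * T' => s ^+ 2 * f' p).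
  exact: measurable_funM.
have s2f'C p : `|s ^+ 2 * f' p| <= s ^+ 2 * C * (1 + `|p.1|).
  by rewrite normrM ger0_norm ?sqr_ge0// -mulrA ler_wpM2l ?sqr_ge0.
rewrite -integralZl//; last exact: integrable_phi mf' f'C.
under [RHS]eq_integral do rewrite -EFinM.
rewrite (integral_phi mxf xfC) (integral_phi ms2f' s2f'C).
apply: eq_integral => w _ /=.
have mfw : measurable_fun [set: R] (fun x => f (x, w)).
  exact: measurableT_comp mf (measurable_pair2 w).
have mfw' : measurable_fun [set: R] (fun x => f' (x, w)).
  exact: measurableT_comp mf' (measurable_pair2 w).
have mxfw : measurable_fun [set: R] (fun x => x * f (x, w)).
  exact: measurable_funM.
have ms2fw' : measurable_fun [set: R] (fun x => s ^+ 2 * f' (x, w)).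
  exact: measurable_funM.
have i1 := integrable_normal_prob s0 mxfw (fun x => xfC (x, w)).
have i2 := integrable_normal_prob s0 ms2fw' (fun x => s2f'C (x, w)).
have i3 := integrable_normal_prob s0 mfw' (fun x => f'C (x, w)).
rewrite (integral_normal_law i1) (integral_normal_law i2).
by rewrite (normal_stein s0 (fun x y => fC x y w)) -integralZl.
Qed.
End indep.

(** * Complex-valued functions *)

Section complex_parts.
Context (R : realType).
Implicit Types x y : R[i].

Lemma cReD x y : complex.Re (x + y) = complex.Re x + complex.Re y.
Proof. by case: x y => [? ?] []. Qed.
Lemma cImD x y : complex.Im (x + y) = complex.Im x + complex.Im y.
Proof. by case: x y => [? ?] []. Qed.
Lemma cReN x : complex.Re (- x) = - complex.Re x.
Proof. by case: x. Qed.
Lemma cImN x : complex.Im (- x) = - complex.Im x.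
Proof. by case: x. Qed.
Lemma cReM x y : complex.Re (x * y) =
  complex.Re x * complex.Re y - complex.Im x * complex.Im y.
Proof. by case: x y => [? ?] []. Qed.
Lemma cImM x y : complex.Im (x * y) =
  complex.Re x * complex.Im y + complex.Im x * complex.Re y.
Proof. by case: x y => [? ?] []. Qed.

Lemma norm_real_complex (r : R) : `|r%:C| = `|r|%:C.
Proof. by rewrite normc_def/= expr0n addr0 sqrtr_sqr. Qed.

Lemma normD_real_le x y (K L : R) :
  `|x| <= K%:C -> `|y| <= L%:C -> `|x + y| <= (K + L)%:C.
Proof. by move=> xK yL; rewrite rmorphD (le_trans (ler_normD _ _))// lerD. Qed.

Lemma normM_real_le x y (K L : R) :
  `|x| <= K%:C -> `|y| <= L%:C -> `|x * y| <= (K * L)%:C.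
Proof. by move=> xK yL; rewrite rmorphM normrM ler_pM. Qed.

Lemma Re_le_norm x (K : R) : `|x| <= K%:C -> `|complex.Re x| <= K.
Proof. by move=> /(le_trans (normc_ge_Re x)); rewrite lecR. Qed.

Lemma Im_le_norm x (K : R) : `|x| <= K%:C -> `|complex.Im x| <= K.
Proof.
move=> xK; have := @Re_le_norm ('i * x) K; rewrite cReM/= mul0r sub0r mul1r normrN.
apply; rewrite normrM [`|'i|](_ : _ = 1) ?mul1r//.
by rewrite normc_def/= expr0n expr1n add0r sqrtr1.
Qed.

End complex_parts.

(** * Measurable and bounded complex-valued functions *)

Section measurable_complex.
Context d (U : measurableType d) (R : realType).
Implicit Types f g : U -> R[i].

(** Real and imaginary parts are treated separately, as in [cexpect]. *)
Definition cmeasurable f :=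
  measurable_fun setT (fun u => complex.Re (f u)) /\
  measurable_fun setT (fun u => complex.Im (f u)).

Lemma cmeasurable_real (h : U -> R) :
  measurable_fun setT h -> cmeasurable (fun u => (h u)%:C).
Proof. by split. Qed.

Lemma cmeasurable_cst c : cmeasurable (fun=> c).
Proof. by split; exact: measurable_cst. Qed.

Lemma cmeasurableD f g :
  cmeasurable f -> cmeasurable g -> cmeasurable (fun u => f u + g u).
Proof.
move=> [f1 f2] [g1 g2]; split.
  by under eq_fun do rewrite cReD; exact: measurable_funD.
by under eq_fun do rewrite cImD; exact: measurable_funD.
Qed.

Lemma cmeasurableM f g :
  cmeasurable f -> cmeasurable g -> cmeasurable (fun u => f u * g u).
Proof.
move=> [f1 f2] [g1 g2]; split.
  by under eq_fun do rewrite cReM; apply: measurable_funB; exact: measurable_funM.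
by under eq_fun do rewrite cImM; apply: measurable_funD; exact: measurable_funM.
Qed.

(** On nonnegative reals inversion is the power -1, also at 0, where both take the value 0; powers
    are measurable. *)
Lemma measurable_funV_ge0 (h : U -> R) : (forall u, 0 <= h u) ->
  measurable_fun setT h -> measurable_fun setT (fun u => (h u)^-1).
Proof.
move=> h0 mh; under eq_fun do rewrite -powR_inv1//.
exact: measurableT_comp (measurable_powR _) mh.
Qed.

Lemma cmeasurableV f : cmeasurable f -> cmeasurable (fun u => (f u)^-1).
Proof.
move=> [f1 f2].
have mn : measurable_fun setT
    (fun u => (complex.Re (f u) ^+ 2 + complex.Im (f u) ^+ 2)^-1).
  apply: measurable_funV_ge0; first by move=> u; rewrite addr_ge0 ?sqr_ge0.
  by apply: measurable_funD; exact: measurable_funX.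
split.
  rewrite (_ : (fun _ => _) = (fun u => complex.Re (f u) *
    (complex.Re (f u) ^+ 2 + complex.Im (f u) ^+ 2)^-1)); first exact: measurable_funM.
  by apply/funext => u; case: (f u).
rewrite (_ : (fun _ => _) = (fun u => - complex.Im (f u) *
    (complex.Re (f u) ^+ 2 + complex.Im (f u) ^+ 2)^-1)).
  by apply: measurable_funM => //; exact: measurable_funN.
by apply/funext => u; case: (f u) => a b /=; rewrite mulNr.
Qed.

Lemma cmeasurable_sum (I : Type) (r : seq I) (F : I -> U -> R[i]) :
  (forall i, cmeasurable (F i)) -> cmeasurable (fun u => \sum_(i <- r) F i u).
Proof.
move=> mF; elim: r => [|i r ih].
  by under eq_fun do rewrite big_nil; exact: cmeasurable_cst.
by under eq_fun do rewrite big_cons; exact: cmeasurableD.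
Qed.

Lemma cmeasurable_prod (I : Type) (r : seq I) (F : I -> U -> R[i]) :
  (forall i, cmeasurable (F i)) -> cmeasurable (fun u => \prod_(i <- r) F i u).
Proof.
move=> mF; elim: r => [|i r ih].
  by under eq_fun do rewrite big_nil; exact: cmeasurable_cst.
by under eq_fun do rewrite big_cons; exact: cmeasurableM.
Qed.

Definition cbounded f := cmeasurable f /\ exists K : R, forall u, `|f u| <= K%:C.

Lemma cbounded_cst c : cbounded (fun=> c).
Proof.
split; first exact: cmeasurable_cst.
by exists (complex.Re `|c|) => _; rewrite RRe_real ?normr_real.
Qed.

Lemma cboundedD f g : cbounded f -> cbounded g -> cbounded (fun u => f u + g u).
Proof.
move=> [mf [K fK]] [mg [L gL]]; split; first exact: cmeasurableD.
by exists (K + L) => u; exact: normD_real_le.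
Qed.

Lemma cboundedM f g : cbounded f -> cbounded g -> cbounded (fun u => f u * g u).
Proof.
move=> [mf [K fK]] [mg [L gL]]; split; first exact: cmeasurableM.
by exists (K * L) => u; exact: normM_real_le.
Qed.

Lemma cboundedN f : cbounded f -> cbounded (fun u => - f u).
Proof.
move=> bf; under eq_fun do rewrite -mulN1r.
by apply: cboundedM => //; exact: cbounded_cst.
Qed.

Lemma cbounded_sum (I : Type) (r : seq I) (F : I -> U -> R[i]) :
  (forall i, cbounded (F i)) -> cbounded (fun u => \sum_(i <- r) F i u).
Proof.
move=> mF; elim: r => [|i r ih].
  by under eq_fun do rewrite big_nil; exact: cbounded_cst.
by under eq_fun do rewrite big_cons; exact: cboundedD.
Qed.

Lemma cboundedX f n : cbounded f -> cbounded (fun u => f u ^+ n).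
Proof.
move=> bf; elim: n => [|n ih].
  by under eq_fun do rewrite expr0; exact: cbounded_cst.
by under eq_fun do rewrite exprS; exact: cboundedM.
Qed.

Lemma cbounded_prod (I : Type) (r : seq I) (F : I -> U -> R[i]) :
  (forall i, cbounded (F i)) -> cbounded (fun u => \prod_(i <- r) F i u).
Proof.
move=> mF; elim: r => [|i r ih].
  by under eq_fun do rewrite big_nil; exact: cbounded_cst.
by under eq_fun do rewrite big_cons; exact: cboundedM.
Qed.

End measurable_complex.

Lemma cbounded_comp d d' (U : measurableType d) (V : measurableType d')
    (R : realType) (phi : U -> V) (f : V -> R[i]) :
  measurable_fun setT phi -> cbounded f -> cbounded (f \o phi).
Proof.
move=> mphi [[m1 m2] [K fK]]; split; last by exists K => u; exact: fK.
split; [exact: (measurableT_comp m1 mphi)|exact: (measurableT_comp m2 mphi)].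
Qed.

(** * Linearity of the complex expectation *)

Section complex_expectation.
Context d (U : measurableType d) (R : realType) (P : probability U R).
Implicit Types f g : U -> R[i].

Definition cintegrable f :=
  P.-integrable setT (fun u => (complex.Re (f u))%:E) /\
  P.-integrable setT (fun u => (complex.Im (f u))%:E).

Lemma cexpectE f : cexpect P f =
  Complex (\int[P]_u complex.Re (f u)) (\int[P]_u complex.Im (f u)).
Proof. by rewrite /cexpect unlock. Qed.

Lemma cexpectD f g : cintegrable f -> cintegrable g ->
  cexpect P (fun u => f u + g u) = cexpect P f + cexpect P g.
Proof.
move=> [f1 f2] [g1 g2]; rewrite !cexpectE.
under eq_Rintegral do rewrite cReD.
under [X in Complex _ X]eq_Rintegral do rewrite cImD.
by rewrite !RintegralD.
Qed.

Lemma cexpect_cstM c f : cintegrable f ->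
  cexpect P (fun u => c * f u) = c * cexpect P f.
Proof.
move=> [f1 f2]; rewrite !cexpectE.
under eq_Rintegral do rewrite cReM.
under [X in Complex _ X]eq_Rintegral do rewrite cImM.
have h r (g : U -> R) : P.-integrable setT (fun u => (g u)%:E) ->
  P.-integrable setT (fun u => (r * g u)%:E).
  by move=> ig; under eq_fun do rewrite EFinM; exact: integrableZl.
rewrite RintegralB ?RintegralD ?RintegralZl//; do ?exact: h.
by case: c.
Qed.

Lemma cintegrableD f g : cintegrable f -> cintegrable g ->
  cintegrable (fun u => f u + g u).
Proof.
move=> [f1 f2] [g1 g2]; split.
  by under eq_fun do rewrite cReD EFinD; exact: integrableD.
by under eq_fun do rewrite cImD EFinD; exact: integrableD.
Qed.

Lemma cbounded_integrable f : cbounded f -> cintegrable f.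
Proof.
move=> [[m1 m2] [K fK]]; split; apply: measurable_bounded_integrable => //.
- by rewrite -ge0_fin_numE// fin_num_measure.
- exists K; split => [|x Kx u _]; first exact: num_real.
  exact: le_trans (Re_le_norm (fK u)) (ltW Kx).
- by rewrite -ge0_fin_numE// fin_num_measure.
- exists K; split => [|x Kx u _]; first exact: num_real.
  exact: le_trans (Im_le_norm (fK u)) (ltW Kx).
Qed.

(** Meant for an entry [a i j] times a function of the resolvent: the entry is the only unbounded
    factor. *)
Lemma cintegrableM_bounded (X : U -> R) f :
  P.-integrable setT (EFin \o X) -> cbounded f ->
  cintegrable (fun u => (X u)%:C * f u).
Proof.
move=> iX [[m1 m2] [K fK]].
have h (g : U -> R) : measurable_fun setT g -> (forall u, `|g u| <= K) ->
  P.-integrable setT (fun u => (X u * g u)%:E).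
  move=> mg gK; under eq_fun do rewrite EFinM.
  apply: (@integrableMl _ _ _ P setT measurableT (EFin \o X) g iX mg).
  exists K; split => [|x Kx u _]; first exact: num_real.
  exact: le_trans (gK u) (ltW Kx).
split.
  under eq_fun do rewrite cReM/= mul0r subr0.
  by apply: h => // u; exact: Re_le_norm.
under eq_fun do rewrite cImM/= mul0r addr0.
by apply: h => // u; exact: Im_le_norm.
Qed.

Lemma cexpectB f g : cbounded f -> cbounded g ->
  cexpect P (fun u => f u - g u) = cexpect P f - cexpect P g.
Proof.
move=> bf bg; rewrite -[X in _ = _ + X]mulN1r -cexpect_cstM; last first.
  exact: cbounded_integrable.
rewrite -cexpectD; [|exact: cbounded_integrable|]; last first.
  by apply/cbounded_integrable/cboundedM => //; exact: cbounded_cst.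
by apply: (congr1 (cexpect P)); apply/funext => u; rewrite mulN1r.
Qed.

Lemma cexpect_sum (I : Type) (r : seq I) (F : I -> U -> R[i]) :
  (forall i, cintegrable (F i)) ->
  cexpect P (fun u => \sum_(i <- r) F i u) = \sum_(i <- r) cexpect P (F i).
Proof.
move=> iF; elim: r => [|i r ih].
  rewrite big_nil cexpectE; under eq_Rintegral do rewrite big_nil.
  under [X in Complex _ X]eq_Rintegral do rewrite big_nil.
  by rewrite !Rintegral_cst// !mul0r.
rewrite big_cons -ih -cexpectD//.
  by congr cexpect; apply/funext => u; rewrite big_cons.
elim: r {ih} => [|j r ih].
  by apply: cbounded_integrable; under eq_fun do rewrite big_nil; exact: cbounded_cst.
by under eq_fun do rewrite big_cons; exact: cintegrableD.
Qed.

End complex_expectation.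

(** * Calculus of a uniform partial derivative *)

Section cdiff.
Context d (W : measurableType d) (R : realType).
Implicit Types f g : R * W -> R[i].

(* [f'] is the partial derivative of [f] in the first variable; the quadratic
   bound on the remainder is uniform, so that the notion is stable under sums
   and products by elementary estimates. *)
Definition cdiff f f' := [/\ cbounded f, cbounded f' &
  exists K : R, forall x y w,
    `|f (y, w) - f (x, w)| <= (K * `|y - x|)%:C /\
    `|f (y, w) - f (x, w) - (y - x)%:C * f' (x, w)| <= (K * (y - x) ^+ 2)%:C].

Lemma cdiff_ext f f1 f2 : cdiff f f1 -> f1 =1 f2 -> cdiff f f2.
Proof. by move=> + /funext <-. Qed.

Lemma cdiff_cst c : cdiff (fun=> c) (fun=> 0).
Proof.
split; [exact: cbounded_cst..|exists 0 => x y w].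
by rewrite subrr mulr0 subrr normr0 !mul0r lexx.
Qed.

Lemma cdiffD f f' g g' : cdiff f f' -> cdiff g g' ->
  cdiff (fun p => f p + g p) (fun p => f' p + g' p).
Proof.
move=> [bf bf' [K fK]] [bg bg' [L gL]]; split; [exact: cboundedD..|].
exists (K + L) => x y w; have [f1 f2] := fK x y w; have [g1 g2] := gL x y w.
split; rewrite mulrDl.
  rewrite (_ : _ - _ = (f (y, w) - f (x, w)) + (g (y, w) - g (x, w))); last by ring.
  exact: normD_real_le.
rewrite (_ : _ - _ = (f (y, w) - f (x, w) - (y - x)%:C * f' (x, w)) +
   (g (y, w) - g (x, w) - (y - x)%:C * g' (x, w))); last by ring.
exact: normD_real_le.
Qed.

Lemma cdiffM f f' g g' : cdiff f f' -> cdiff g g' ->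
  cdiff (fun p => f p * g p) (fun p => f' p * g p + f p * g' p).
Proof.
move=> [bf bf' [K fK]] [bg bg' [L gL]]; split.
- exact: cboundedM.
- by apply: cboundedD; exact: cboundedM.
have [_ [A fA]] := bf; have [_ [A' fA']] := bf'; have [_ [B gB]] := bg.
exists (K * B + A * L + A' * L) => x y w.
have [f1 f2] := fK x y w; have [g1 g2] := gL x y w.
have A'L0 : 0 <= A' * L * `|y - x|.
  rewrite -mulrA mulr_ge0// -ler0c.
    exact: le_trans (normr_ge0 _) (fA' (x, w)).
  exact: le_trans (normr_ge0 _) g1.
split.
  apply: (@le_trans _ _ ((K * `|y - x|) * B + A * (L * `|y - x|))%:C); last first.
    by rewrite lecR !mulrDl mulrAC mulrA lerDl.
  rewrite (_ : _ - _ = (f (y, w) - f (x, w)) * g (y, w) +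
    f (x, w) * (g (y, w) - g (x, w))); last by ring.
  by apply: normD_real_le; exact: normM_real_le.
(* The last of the three terms is quadratic in [y - x] only because [g] is Lipschitz, hence the
   first-order bound recorded in [cdiff]. *)
rewrite (_ : _ - _ = (f (y, w) - f (x, w) - (y - x)%:C * f' (x, w)) * g (y, w)
   + f (x, w) * (g (y, w) - g (x, w) - (y - x)%:C * g' (x, w))
   + f' (x, w) * ((y - x)%:C * (g (y, w) - g (x, w)))); last by ring.
rewrite (_ : _ * _ ^+ 2 = K * (y - x) ^+ 2 * B + A * (L * (y - x) ^+ 2) +
    A' * (`|y - x| * (L * `|y - x|))); last first.
  by rewrite -(real_normK (num_real (y - x))); ring.
apply: normD_real_le; first by apply: normD_real_le; exact: normM_real_le.
apply: normM_real_le => //; apply: normM_real_le => //.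
by rewrite norm_real_complex.
Qed.

Lemma cdiffZ c f f' : cdiff f f' -> cdiff (fun p => c * f p) (fun p => c * f' p).
Proof.
move=> df; apply: cdiff_ext (cdiffM (cdiff_cst c) df) _ => p.
by rewrite mul0r add0r.
Qed.

Lemma cdiff_sum (I : Type) (r : seq I) (F F' : I -> R * W -> R[i]) :
  (forall i, cdiff (F i) (F' i)) ->
  cdiff (fun p => \sum_(i <- r) F i p) (fun p => \sum_(i <- r) F' i p).
Proof.
move=> dF; elim: r => [|i r ih].
  rewrite (_ : (fun _ => _) = (fun=> 0)); last by apply/funext => p; rewrite big_nil.
  by rewrite (_ : (fun p => \sum_(i <- _) F' i p) = (fun=> 0)) ?funeqE;
    [exact: cdiff_cst|move=> p; rewrite big_nil].
have := cdiffD (dF i) ih.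
rewrite (_ : (fun p => F i p + _) = fun p => \sum_(j <- i :: r) F j p); last first.
  by apply/funext => p; rewrite big_cons.
rewrite (_ : (fun p => F' i p + _) = fun p => \sum_(j <- i :: r) F' j p)//.
by apply/funext => p; rewrite big_cons.
Qed.

Lemma cdiffX f f' n : cdiff f f' ->
  cdiff (fun p => f p ^+ n) (fun p => n%:R * f p ^+ n.-1 * f' p).
Proof.
move=> df; elim: n => [|n ih].
  under eq_fun do rewrite expr0.
  by apply: cdiff_ext (cdiff_cst 1) _ => p; rewrite !mul0r.
under eq_fun do rewrite exprS.
apply: cdiff_ext (cdiffM df ih) _ => p /=; case: n {ih} => [|n]; first by ring.
by rewrite /= exprS; ring.
Qed.

(** The exponents are those of the multi-index K - e_l. Their truncation at 0 is harmless, since the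
    coefficient [K l] vanishes in that case. *)
Lemma cdiff_prod (m : nat) (F F' : 'I_m -> R * W -> R[i]) (K : 'I_m -> nat) :
  (forall i, cdiff (F i) (F' i)) ->
  cdiff (fun p => \prod_(i < m) F i p ^+ K i)
    (fun p => \sum_(l < m) (K l)%:R * F' l p *
       \prod_(i < m) F i p ^+ (K i - (i == l))).
Proof.
elim: m F F' K => [|m ih] F F' K dF.
  under eq_fun do rewrite big_ord0.
  by apply: cdiff_ext (cdiff_cst 1) _ => p; rewrite big_ord0.
under eq_fun do rewrite big_ord_recl.
have := cdiffM (cdiffX (K ord0) (dF ord0))
  (ih _ _ (fun i => K (lift ord0 i)) (fun i => dF (lift ord0 i))).
move=> /cdiff_ext; apply => p /=; rewrite big_ord_recl; congr (_ + _).
  rewrite big_ord_recl /= subn1 [X in X * _ = _]mulrAC -!mulrA; congr (_ * (_ * (_ * _))).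
  by apply: eq_bigr => i _; rewrite subn0.
rewrite mulr_sumr; apply: eq_bigr => l _.
rewrite big_ord_recl /= subn0 mulrCA; congr (_ * (_ * _)).
Qed.

(** The increment [y - x] is real, so the estimates pass to both parts. The maximum of all bounds
    gives the single constant expected by the real Stein lemma. *)
Lemma cdiff_parts f f' : cdiff f f' -> exists C : R, forall x y w,
  [/\ `|complex.Re (f (x, w))| <= C, `|complex.Re (f' (x, w))| <= C,
      `|complex.Re (f (y, w)) - complex.Re (f (x, w))| <= C * `|y - x| &
      `|complex.Re (f (y, w)) - complex.Re (f (x, w)) -
        (y - x) * complex.Re (f' (x, w))| <= C * (y - x) ^+ 2] /\
  [/\ `|complex.Im (f (x, w))| <= C, `|complex.Im (f' (x, w))| <= C,
      `|complex.Im (f (y, w)) - complex.Im (f (x, w))| <= C * `|y - x| &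
      `|complex.Im (f (y, w)) - complex.Im (f (x, w)) -
        (y - x) * complex.Im (f' (x, w))| <= C * (y - x) ^+ 2].
Proof.
move=> [[_ [A fA]] [_ [A' fA']] [K fK]].
exists (Num.max (Num.max A A') K) => x y w; set C := Num.max _ _.
have AC : A <= C by rewrite !le_max lexx.
have A'C : A' <= C by rewrite !le_max lexx orbT.
have KC : K <= C by rewrite !le_max lexx orbT.
have [f1 f2] := fK x y w.
have e0 : complex.Re (f (y, w) - f (x, w) - (y - x)%:C * f' (x, w)) =
  complex.Re (f (y, w)) - complex.Re (f (x, w)) - (y - x) * complex.Re (f' (x, w)).
  by rewrite !(cReD, cReN) cReM/= mul0r subr0.
have e1 : complex.Im (f (y, w) - f (x, w) - (y - x)%:C * f' (x, w)) =
  complex.Im (f (y, w)) - complex.Im (f (x, w)) - (y - x) * complex.Im (f' (x, w)).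
  by rewrite !(cImD, cImN) cImM/= mul0r addr0.
split; split.
- exact: le_trans (Re_le_norm (fA _)) AC.
- exact: le_trans (Re_le_norm (fA' _)) A'C.
- by rewrite -cReN -cReD (le_trans (Re_le_norm f1))// ler_wpM2r.
- by rewrite -e0 (le_trans (Re_le_norm f2))// ler_wpM2r// sqr_ge0.
- exact: le_trans (Im_le_norm (fA _)) AC.
- exact: le_trans (Im_le_norm (fA' _)) A'C.
- by rewrite -cImN -cImD (le_trans (Im_le_norm f1))// ler_wpM2r.
- by rewrite -e1 (le_trans (Im_le_norm f2))// ler_wpM2r// sqr_ge0.
Qed.

End cdiff.

Section complex_stein.
Context d (T : measurableType d) (R : realType) (P : probability T R).
Variables (X : {RV P >-> R}) (s : R) (G : set (set T)).
Hypothesis s0 : 0 < s.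
Hypothesis lawX : forall B : set R, measurable B ->
  distribution P X B = normal_prob 0 s B.
Hypothesis Gm : G `<=` measurable.
Hypothesis GI : setI_closed G.
Hypothesis GT : G setT.
Hypothesis indep : forall (B : set R) A, measurable B -> G A ->
  P (X @^-1` B `&` A) = (P (X @^-1` B) * P A)%E.

Lemma complex_stein (f f' : R * g_sigma_algebraType G -> R[i]) : cdiff f f' ->
  cexpect P (fun w => (X w)%:C * f (X w, w)) =
  (s ^+ 2)%:C * cexpect P (fun w => f' (X w, w)).
Proof.
move=> df; have [[[m1 m2] _] [[m1' m2'] _] _] := df.
have [C fC] := cdiff_parts df.
rewrite !cexpectE.
under eq_Rintegral do rewrite cReM/= mul0r subr0.
under [X in Complex _ X]eq_Rintegral do rewrite cImM/= mul0r addr0.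
rewrite /Rintegral.
rewrite (indep_stein s0 lawX Gm GI GT indep m1 m1' (fun x y w => (fC x y w).1)).
rewrite (indep_stein s0 lawX Gm GI GT indep m2 m2' (fun x y w => (fC x y w).2)).
have [i1 i2] : cintegrable P (fun w => f' (X w, w)).
  have [_ bf' _] := df; apply: cbounded_integrable.
  exact: cbounded_comp (measurable_indep_pair X Gm) bf'.
rewrite !fineM ?integrable_fin_num//=.
by apply/eqP; rewrite eq_complex/= !mul0r subr0 addr0 !eqxx.
Qed.

End complex_stein.

(** * Independence of the matrix entries *)

Section entry_system.
Context d (T : measurableType d) (R : realType) (P : probability T R).
Variable a : nat -> nat -> {RV P >-> R}.
Hypothesis goe : GOE_family a.

(** Cylinder events of the entries listed in [s]: a pi-system generating their sigma-algebra.
    Indexing [B] by all pairs makes intersections componentwise. *)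
Definition entry_system (s : seq (nat * nat)) : set (set T) :=
  [set A | exists2 B : nat * nat -> set R, (forall p, measurable (B p)) &
    A = \big[setI/setT]_(p <- s) (a p.1 p.2 @^-1` B p)].

Lemma measurable_entry i j (B : set R) : measurable B -> measurable (a i j @^-1` B).
Proof. by move=> mB; rewrite -[X in measurable X]setTI; exact: measurable_funP. Qed.

Lemma entry_system_measurable s : entry_system s `<=` measurable.
Proof.
move=> _ [B mB ->]; apply: bigsetI_measurable => p _; exact: measurable_entry.
Qed.

Lemma entry_system_setI s : setI_closed (entry_system s).
Proof.
move=> _ _ [B mB ->] [B' mB' ->]; exists (fun p => B p `&` B' p).
  by move=> p; exact: measurableI.
by rewrite -big_split.
Qed.

Lemma entry_system_setT s : entry_system s setT.
Proof. by exists (fun=> setT) => //; rewrite big1_seq. Qed.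

Lemma measurable_entry_system s p : p \in s ->
  measurable_fun [set: g_sigma_algebraType (entry_system s)]
    (a p.1 p.2 : g_sigma_algebraType (entry_system s) -> R).
Proof.
move=> ps _ B mB; rewrite setTI; apply: sub_sigma_algebra.
exists (fun q => if q == p then B else setT); first by move=> q; case: ifP.
rewrite -bigcap_seq; apply/seteqP; split => w /=.
  by move=> Bw q qs /=; case: eqP => [->//|].
by move=> /(_ p ps); rewrite /= eqxx.
Qed.

(** The product formula is used twice, for [(i, j) :: s] and for [s] alone. As [(i, j)] is not in
    [s], overriding [B'] there by [B] leaves the cylinder [A] unchanged. *)
Lemma entry_system_indep s i j (B : set R) A :
  uniq ((i, j) :: s) -> all (fun p => p.1 <= p.2)%N ((i, j) :: s) ->
  measurable B -> entry_system s A ->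
  P (a i j @^-1` B `&` A) = (P (a i j @^-1` B) * P A)%E.
Proof.
move=> us ls mB [B' mB' ->]; have [_ _ indep] := goe.
pose B2 p := if p == (i, j) then B else B' p.
have mB2 p : measurable (B2 p) by rewrite /B2; case: ifP.
have eB2 : \big[setI/setT]_(p <- s) (a p.1 p.2 @^-1` B2 p) =
           \big[setI/setT]_(p <- s) (a p.1 p.2 @^-1` B' p).
  apply: eq_big_seq => p ps; rewrite /B2; case: eqP => // pij.
  by move: us; rewrite /= -pij ps.
have := indep _ us ls _ mB2; rewrite !big_cons eB2 /= {1 2}/B2 eqxx => ->.
move: us ls => /= /andP[_ us] /andP[_ ls].
by rewrite -(indep _ us ls _ mB2) eB2.
Qed.

Lemma GOE_stein s i j (f f' : R * g_sigma_algebraType (entry_system s) -> R[i]) :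
  uniq ((i, j) :: s) -> all (fun p => p.1 <= p.2)%N ((i, j) :: s) -> cdiff f f' ->
  cexpect P (fun w => (a i j w)%:C * f (a i j w, w)) =
  (1 + (i == j)%:R) * cexpect P (fun w => f' (a i j w, w)).
Proof.
move=> us ls df; have [_ law _] := goe.
have s0 : 0 < Num.sqrt (1 + (i == j)%:R) :> R by rewrite sqrtr_gt0 ltr_pwDl.
rewrite (complex_stein s0 (law i j) (@entry_system_measurable s)
  (@entry_system_setI s) (@entry_system_setT s) _ df); last first.
  by move=> B A; exact: entry_system_indep.
by rewrite sqr_sqrtr ?addr_ge0// rmorphD rmorph1 rmorph_nat.
Qed.

Lemma integrable_GOE_entry i j : P.-integrable setT (EFin \o a i j).
Proof.
have [_ law _] := goe.
have s0 : 0 < Num.sqrt (1 + (i == j)%:R) :> R by rewrite sqrtr_gt0 ltr_pwDl.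
exact: integrable_normal_RV s0 (law i j).
Qed.

End entry_system.

(** * The resolvent of a real symmetric matrix *)

Section resolvent.
Context (R : realType) (n : nat) (om : R[i]).
Hypothesis om_im : complex.Im om != 0.
Implicit Types M : 'M[R]_n.

(** The matrix is an argument, unlike in [resolv], so that a single entry can be varied. *)
Definition resolvent M : 'M[R[i]]_n := invmx (map_mx (real_complex R) M - om%:M).

Local Notation A M := (map_mx (real_complex R) M - om%:M).

(* The imaginary part of [v A v^*] is that of [- om |v|^2], the matrix being
   real symmetric. *)
Lemma hermitian_form_im M (v : 'rV[R[i]]_n) S : M^T = M ->
  S = \sum_l (v *m A M) 0 l * (v 0 l)^*%C ->
  S - S^*%C = (om^*%C - om) * \sum_l `|v 0 l| ^+ 2.
Proof.
move=> sM ->.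
pose q := \sum_l (v *m map_mx (real_complex R) M) 0 l * (v 0 l)^*%C.
have -> : \sum_l (v *m A M) 0 l * (v 0 l)^*%C = q - om * \sum_l `|v 0 l| ^+ 2.
  rewrite mulr_sumr -sumrB; apply: eq_bigr => l _.
  by rewrite mulmxBr mul_mx_scalar !mxE sqr_normc; ring.
have qJ : q^*%C = q.
  rewrite /q rmorph_sum/=.
  under eq_bigr do rewrite rmorphM/= conjcK mxE rmorph_sum/= mulr_suml.
  rewrite exchange_big/=; apply: eq_bigr => k _.
  rewrite mxE mulr_suml; apply: eq_bigr => l _.
  by rewrite rmorphM/= !mxE conjc_real -{1}sM mxE; ring.
have NJ : (\sum_l `|v 0 l| ^+ 2)^*%C = \sum_l `|v 0 l| ^+ 2.
  rewrite rmorph_sum; apply: eq_bigr => l _.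
  by rewrite -add_Re2_Im2; exact: conjc_real.
by rewrite rmorphB rmorphM/= qJ NJ; ring.
Qed.

Let be_gt0 : 0 < `|om^*%C - om|.
Proof.
rewrite normr_gt0 subr_eq0; apply: contra om_im => /eqP.
case: om => x y /= [/eqP]; rewrite eq_sym -subr_eq0 opprK -mulr2n.
by rewrite mulrn_eq0.
Qed.

(** A row [v] of the left kernel has form value 0, so (conj om - om) |v|^2 = 0 and [v] vanishes
    because [om] is not real. *)
Lemma resolvent_unit M : M^T = M -> A M \in unitmx.
Proof.
move=> sM; rewrite -row_free_unit -kermx_eq0; apply/eqP/row_matrixP => k.
rewrite row0; apply/rowP => l; rewrite [RHS]mxE.
set v := row k _; have vA : v *m A M = 0 by rewrite -row_mul mulmx_ker row0.
have := @hermitian_form_im M v 0 sM; rewrite vA big1 => [/(_ erefl)|k' _]; last first.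
  by rewrite mxE mul0r.
rewrite conjc0 subrr => /esym/eqP; rewrite mulf_eq0 -normr_eq0 gt_eqF//=.
rewrite psumr_eq0; last by move=> i _; rewrite exprn_ge0.
by move=> /allP/(_ l (mem_index_enum _)); rewrite /= expf_eq0 normr_eq0 => /eqP.
Qed.

Lemma mul_resolvent M : M^T = M -> A M *m resolvent M = 1%:M.
Proof. by move=> sM; rewrite mulmxV// resolvent_unit. Qed.

Lemma resolvent_mul M : M^T = M -> resolvent M *m A M = 1%:M.
Proof. by move=> sM; rewrite mulVmx// resolvent_unit. Qed.

Lemma tr_resolvent M : M^T = M -> (resolvent M)^T = resolvent M.
Proof.
move=> sM; rewrite /resolvent trmx_inv; congr invmx.
by rewrite linearB/= map_trmx sM tr_scalar_mx.
Qed.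

(** Row [i] of the resolvent satisfies v A = e_i, so its form value is the conjugate of v_i. With be
    = |conj om - om| this gives be |v|^2 <= 2 |v_i|, hence be |v_i| <= 2, then be^2 |v_j|^2 <= 4. *)
Lemma resolvent_bound : exists K : R, forall M, M^T = M ->
  forall i j, `|resolvent M i j| <= K%:C.
Proof.
exists (complex.Re (2 / `|om^*%C - om|)) => M sM i j.
have ge0 : 0 <= 2 / `|om^*%C - om| by rewrite divr_ge0.
rewrite RRe_real ?ger0_real// ler_pdivlMr// mulrC.
set be := `|_ - _| in ge0 *; have be0 : 0 <= be by exact: normr_ge0.
pose v := row i (resolvent M).
have vA : v *m A M = delta_mx 0 i by rewrite -row_mul resolvent_mul// row1.
have -> : resolvent M i j = v 0 j by rewrite mxE.
move: v vA => v vA.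
have N k : `|v 0 k| ^+ 2 <= \sum_l `|v 0 l| ^+ 2.
  by rewrite (bigD1 k)//= lerDl sumr_ge0// => l _; rewrite exprn_ge0.
have key : be * \sum_l `|v 0 l| ^+ 2 <= 2 * `|v 0 i|.
  have := @hermitian_form_im M v (v 0 i)^*%C sM; rewrite vA.
  rewrite [X in _ = X -> _](bigD1 i)//= [X in _ + X]big1; last first.
    by move=> l li; rewrite mxE eqxx (negPf li) mul0r.
  rewrite mxE !eqxx mul1r addr0 conjcK => /(_ erefl) /(congr1 Num.norm).
  rewrite normrM [X in _ = _ * X]ger0_norm; last first.
    by apply: sumr_ge0 => l _; rewrite exprn_ge0.
  by move=> <-; rewrite (le_trans (ler_normB _ _))// normcJ mulr_natl mulr2n.
have be_vi : be * `|v 0 i| <= 2.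
  have [v0|v0] := eqVneq `|v 0 i| 0; first by rewrite v0 mulr0.
  rewrite -(@ler_pM2r _ `|v 0 i|) ?lt_def ?v0 ?normr_ge0//.
  by rewrite -mulrA -expr2 (le_trans (ler_wpM2l be0 (N i))).
rewrite -(@ler_pXn2r _ 2)// ?nnegrE ?mulr_ge0//.
rewrite exprMn expr2 -mulrA.
apply: le_trans (ler_wpM2l be0 (ler_wpM2l be0 (N j))) _.
apply: le_trans (ler_wpM2l be0 key) _.
by rewrite mulrCA expr2 ler_wpM2l.
Qed.

Lemma resolvent_sub M M' : M^T = M -> M'^T = M' ->
  resolvent M' - resolvent M =
  - (resolvent M' *m map_mx (real_complex R) (M' - M) *m resolvent M).
Proof.
move=> sM sM'.
have -> : map_mx (real_complex R) (M' - M) = A M' - A M.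
  by rewrite map_mxB opprB addrA subrK.
rewrite mulmxBr resolvent_mul// mulmxBl mul1mx -mulmxA mul_resolvent// mulmx1.
by rewrite opprB.
Qed.

End resolvent.

(** * Measurability and bounds for matrix-valued functions *)

Section measurable_matrix.
Context d (U : measurableType d) (R : realType).

Lemma cmeasurable_det n (M : U -> 'M[R[i]]_n) :
  (forall i j, cmeasurable (fun u => M u i j)) -> cmeasurable (fun u => \det (M u)).
Proof.
move=> mM; apply: cmeasurable_sum => s; apply: cmeasurableM.
  exact: cmeasurable_cst.
by apply: cmeasurable_prod => i; exact: mM.
Qed.

(** For invertible matrices [invmx] is the adjugate over the determinant, so each entry is a
    rational function of the entries of [M]. *)
Lemma cmeasurable_invmx n (M : U -> 'M[R[i]]_n) : (forall u, M u \in unitmx) ->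
  (forall i j, cmeasurable (fun u => M u i j)) ->
  forall i j, cmeasurable (fun u => invmx (M u) i j).
Proof.
move=> uM mM i j.
rewrite (_ : (fun _ => _) = (fun u => (\det (M u))^-1 * ((-1) ^+ (j + i) *
    \det (row' j (col' i (M u)))))); last first.
  by apply/funext => u; rewrite /invmx uM !mxE.
apply: cmeasurableM; first exact/cmeasurableV/cmeasurable_det.
apply: cmeasurableM; first exact: cmeasurable_cst.
apply: cmeasurable_det => k l.
by under eq_fun do rewrite !mxE; exact: mM.
Qed.

Definition mxbounded n (M : U -> 'M[R[i]]_n) :=
  forall i j, cbounded (fun u => M u i j).

Lemma mxbounded_mul n (M N : U -> 'M[R[i]]_n) :
  mxbounded M -> mxbounded N -> mxbounded (fun u => M u *m N u).
Proof.
move=> bM bN i j; under eq_fun do rewrite mxE.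
by apply: cbounded_sum => k; exact: cboundedM.
Qed.

Lemma mxbounded_cst n (M : 'M[R[i]]_n) : mxbounded (fun=> M).
Proof. by move=> i j; exact: cbounded_cst. Qed.

Lemma mxboundedX n (M : U -> 'M[R[i]]_n) l :
  mxbounded M -> mxbounded (fun u => M u ^+ l).
Proof.
move=> bM; elim: l => [|l ih].
  by under eq_fun do rewrite expr0; exact: mxbounded_cst.
by under eq_fun do rewrite exprS -mulmxE; exact: mxbounded_mul.
Qed.

Lemma cbounded_trace n (M : U -> 'M[R[i]]_n) :
  mxbounded M -> cbounded (fun u => \tr (M u)).
Proof. by move=> bM; apply: cbounded_sum => k; exact: bM. Qed.

Lemma mxbounded_resolvent n (om : R[i]) (H : U -> 'M[R]_n) :
  complex.Im om != 0 -> (forall u, (H u)^T = H u) ->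
  (forall i j, measurable_fun setT (fun u => H u i j)) ->
  mxbounded (fun u => resolvent om (H u)).
Proof.
move=> om0 sH mH i j; split; last first.
  by have [K HK] := resolvent_bound n om0; exists K => u; exact: HK.
apply: cmeasurable_invmx => [u|k l]; first exact: resolvent_unit.
under eq_fun do rewrite !mxE.
apply: cmeasurableD; last exact: cmeasurable_cst.
exact: cmeasurable_real.
Qed.

End measurable_matrix.

Section matrix_bound.
Context (R : realType) (n : nat).
Implicit Types M N : 'M[R[i]]_n.

(** An entrywise norm: each product costs a factor n, which is harmless since n is fixed and only
    the existence of a bound matters. *)
Definition mxnorm_le M (K : R) := forall i j, `|M i j| <= K%:C.

Lemma mxnorm_le_mul M N K L : mxnorm_le M K -> mxnorm_le N L ->
  mxnorm_le (M *m N) (n%:R * (K * L)).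
Proof.
move=> MK NL i j; rewrite mxE (le_trans (ler_norm_sum _ _ _))//.
apply: (@le_trans _ _ (\sum_(k < n) (K * L)%:C)).
  by apply: ler_sum => k _; exact: normM_real_le.
by rewrite sumr_const card_ord mulr_natl rmorphMn.
Qed.

Lemma mxnorm_le_scale (c : R) M K : mxnorm_le M K ->
  mxnorm_le (c%:C *: M) (`|c| * K).
Proof.
by move=> MK i j; rewrite mxE; apply: normM_real_le; rewrite ?norm_real_complex.
Qed.

Lemma mxnorm_le_exists M : exists K, mxnorm_le M K.
Proof.
exists (complex.Re (\sum_i \sum_j `|M i j|)) => i j.
rewrite RRe_real; last by apply/ger0_real/sumr_ge0 => k _; exact: sumr_ge0.
rewrite (bigD1 i)//= (bigD1 j)//= -addrA lerDl addr_ge0//; first exact: sumr_ge0.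
by apply: sumr_ge0 => k _; exact: sumr_ge0.
Qed.

End matrix_bound.

(** * Differentiation of powers, traces and resolvents *)

Section matrix_cdiff.
Context d (W : measurableType d) (R : realType) (n : nat).
Implicit Types M N : R * W -> 'M[R[i]]_n.

Definition mxdiff M M' := forall i j, cdiff (fun p => M p i j) (fun p => M' p i j).

Lemma mxdiff_cst (M : 'M[R[i]]_n) : mxdiff (fun=> M) (fun=> 0).
Proof. by move=> i j; apply: cdiff_ext (cdiff_cst _ _) _ => p; rewrite mxE. Qed.

Lemma mxdiffM M M' N N' : mxdiff M M' -> mxdiff N N' ->
  mxdiff (fun p => M p *m N p) (fun p => M' p *m N p + M p *m N' p).
Proof.
move=> dM dN i j; under eq_fun do rewrite mxE.
apply: cdiff_ext (cdiff_sum _ (fun k => cdiffM (dM i k) (dN k j))) _ => p.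
by rewrite !mxE -big_split.
Qed.

Lemma mxdiff_trace M M' : mxdiff M M' -> cdiff (fun p => \tr (M p)) (fun p => \tr (M' p)).
Proof. by move=> dM; apply: cdiff_sum => k; exact: dM. Qed.

(** A matrix and its derivative need not commute, so the Leibniz sum is kept; only its trace
    simplifies. *)
Fixpoint mxdiff_pow M M' (l : nat) (p : R * W) : 'M[R[i]]_n :=
  if l is l'.+1 then M' p *m M p ^+ l' + M p *m mxdiff_pow M M' l' p else 0.

Lemma mxdiffX M M' l : mxdiff M M' -> mxdiff (fun p => M p ^+ l) (mxdiff_pow M M' l).
Proof.
move=> dM; elim: l => [|l ih].
  by under eq_fun do rewrite expr0; exact: mxdiff_cst.
by under eq_fun do rewrite exprS -mulmxE; exact: mxdiffM.
Qed.

(** The case of interest is H = 1. The general [H] lets the induction absorb the factors [M p]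
    brought round by cyclicity of the trace. *)
Lemma trace_mxdiff_pow M M' l p (H : 'M[R[i]]_n) : M p *m H = H *m M p ->
  \tr (mxdiff_pow M M' l p *m H) = l%:R * \tr (M' p *m M p ^+ l.-1 *m H).
Proof.
elim: l H => [|l ih] H MH; first by rewrite /= !mul0mx mxtrace0 mul0r.
have MHM : M p *m (H *m M p) = H *m M p *m M p by rewrite mulmxA MH.
rewrite /= mulmxDl mxtraceD -[M p *m _ *m H]mulmxA [\tr (M p *m _)]mxtrace_mulC.
rewrite -[_ *m H *m M p]mulmxA ih// -MH.
case: l {ih} => [|l]; first by rewrite mul0r addr0 mul1r.
rewrite /= -[in RHS]natr1 mulrDl mul1r addrC; congr (_ * \tr _ + _).
by rewrite [in RHS]exprSr -mulmxE !mulmxA.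
Qed.

(** One use of the resolvent identity gives the Lipschitz bound [K1]. A second use shows that the
    Taylor remainder is exactly (y - x)^2 S(y) E S(x) E S(x), bounded entrywise by [K2] times (y -
    x)^2. *)
Lemma mxdiff_resolvent (om : R[i]) (H : R * W -> 'M[R]_n) (E : 'M[R]_n) :
  complex.Im om != 0 -> (forall u, (H u)^T = H u) ->
  (forall i j, measurable_fun setT (fun u => H u i j)) ->
  (forall x y w, H (y, w) - H (x, w) = (y - x) *: E) ->
  let S p := resolvent om (H p) in
  mxdiff S (fun p => - (S p *m map_mx (real_complex R) E *m S p)).
Proof.
move=> om0 sH mH HE S; set CE := map_mx _ E.
have bS : mxbounded S by exact: mxbounded_resolvent.
have bSES : mxbounded (fun p => S p *m CE *m S p).
  by apply: mxbounded_mul => //; apply: mxbounded_mul => //; exact: mxbounded_cst.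
have [K SK] : exists K, forall p, mxnorm_le (S p) K.
  by have [K HK] := resolvent_bound n om0; exists K => p i j; exact: HK.
have [L EL] := mxnorm_le_exists CE.
have SB x y w : S (y, w) - S (x, w) = (- (y - x))%:C *: (S (y, w) *m CE *m S (x, w)).
  by rewrite resolvent_sub// HE map_mxZ -scalemxAr -scalemxAl rmorphN scaleNr.
have SESK p q : mxnorm_le (S p *m CE *m S q) (n%:R * (n%:R * (K * L) * K)).
  by apply: mxnorm_le_mul => //; exact: mxnorm_le_mul.
set K1 := n%:R * _ in SESK.
have SESESK p q :
    mxnorm_le (S p *m CE *m S q *m (CE *m S q)) (n%:R * (K1 * (n%:R * (L * K)))).
  by apply: mxnorm_le_mul => //; exact: mxnorm_le_mul.
set K2 := n%:R * (K1 * _) in SESESK.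
move=> i j; split.
- exact: bS.
- by under eq_fun do rewrite mxE -mulN1r; apply: cboundedM => //; exact: cbounded_cst.
exists (Num.max K1 K2) => x y w; split.
  have -> : S (y, w) i j - S (x, w) i j = (S (y, w) - S (x, w)) i j by rewrite !mxE.
  rewrite SB (le_trans (mxnorm_le_scale _ (SESK _ _) i j))// lecR normrN mulrC.
  by rewrite ler_wpM2r// le_max lexx.
have -> : S (y, w) i j - S (x, w) i j -
    (y - x)%:C * (- (S (x, w) *m CE *m S (x, w))) i j =
    (((y - x) ^+ 2)%:C *: (S (y, w) *m CE *m S (x, w) *m (CE *m S (x, w)))) i j.
  have entry (A B C : 'M[R[i]]_n) h :
      A i j - B i j - h * (- C) i j = (A - B + h *: C) i j.
    by rewrite !mxE; ring.
  rewrite entry; congr (fun_of_matrix _ i j); rewrite SB rmorphN scaleNr addrC -scalerBr.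
  have -> : S (x, w) *m CE *m S (x, w) - S (y, w) *m CE *m S (x, w) =
      - (S (y, w) - S (x, w)) *m CE *m S (x, w) by rewrite opprB !mulmxBl.
  rewrite SB rmorphN scaleNr opprK.
  by rewrite -!scalemxAl scalerA rmorphXn expr2 !mulmxA.
rewrite (le_trans (mxnorm_le_scale _ (SESESK _ _) i j))// lecR.
rewrite normrX real_normK ?num_real//.
by rewrite mulrC ler_wpM2r ?sqr_ge0// le_max lexx orbT.
Qed.

End matrix_cdiff.

(** * The loop equations *)

Section moment_monomials.
Context (R : realType) (n : nat).
Implicit Types (G X : 'M[R[i]]_n) (K L : seq nat).

Definition gl G (l : nat) : R[i] :=
  if l == 1%N then npowC n (- (2 / 3)) * (n%:R + \tr G)
  else npowC n (- (2 * l%:R / 3)) * \tr (G ^+ l).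

Definition gmono K G : R[i] := \prod_(i < size K) gl G i.+1 ^+ nth 0%N K i.

(* With the index shift, component [l.+1] of the multi-index is [nth 0 K l], so
   [gmono_drop K G l] is the monomial of K - e_(l+1), junk if k_(l+1) = 0. *)
Definition gmono_drop K G (l : nat) : R[i] :=
  \prod_(i < size K) gl G i.+1 ^+ (nth 0%N K i - (i == l :> nat)).

(* The derivative of [gmono K] along dG = - G X G. *)
Definition gmono_diff K G X : R[i] :=
  \sum_(l < size K) (nth 0%N K l)%:R *
    (npowC n (- (2 * l.+1%:R / 3)) * (l.+1%:R * - \tr (X *m G ^+ l.+2))) *
    gmono_drop K G l.

(** Padding with zero exponents brings multi-indices of different lengths to a common product
    range. *)
Lemma gmono_widen K G N : (size K <= N)%N ->
  gmono K G = \prod_(i < N) gl G i.+1 ^+ nth 0%N K i.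
Proof.
move=> KN; rewrite /gmono (big_ord_widen N (fun i => gl G i.+1 ^+ nth 0%N K i) KN).
rewrite big_mkcond; apply: eq_bigr => i _; case: ltnP => // Ki.
by rewrite nth_default.
Qed.

Lemma gmono_madd K L G : gmono (madd K L) G = gmono K G * gmono L G.
Proof.
rewrite {1}/gmono size_mkseq (@gmono_widen K _ (maxn (size K) (size L))) ?leq_maxl//.
rewrite (@gmono_widen L _ (maxn (size K) (size L))) ?leq_maxr// -big_split.
by apply: eq_bigr => i _; rewrite nth_mkseq// exprD.
Qed.

Lemma nth_unitmi l i : nth 0%N (unitmi l.+1) i = (i == l).
Proof. by rewrite nth_rcons nth_nseq size_nseq/=; case: ltngtP. Qed.

Lemma size_unitmi l : size (unitmi l.+1) = l.+1.
Proof. by rewrite size_rcons size_nseq. Qed.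

Lemma gmono_unitmi l G : gmono (unitmi l.+1) G = gl G l.+1.
Proof.
rewrite /gmono size_unitmi (bigD1 ord_max)//= nth_unitmi eqxx expr1 big1 ?mulr1//.
move=> i il; rewrite nth_unitmi; case: eqP => [il'|//].
by rewrite -val_eqE/= il' eqxx in il.
Qed.

Lemma gmono_msub K l G : (l < size K)%N ->
  gmono (msub K (unitmi l.+1)) G = gmono_drop K G l.
Proof.
move=> lK; rewrite /gmono size_mkseq size_unitmi (maxn_idPl lK).
by apply: eq_bigr => i _; rewrite nth_mkseq ?size_unitmi ?(maxn_idPl lK)// nth_unitmi.
Qed.

Lemma trace_delta_mul (i j : 'I_n) X :
  \tr ((delta_mx i j + delta_mx j i) *m X) = X j i + X i j.
Proof.
rewrite mulmxDl mxtraceD.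
have h (k l : 'I_n) : \tr (delta_mx k l *m X) = X l k.
  rewrite /mxtrace (bigD1 k)//= mxE (bigD1 l)//= mxE !eqxx mul1r.
  rewrite [X in X + _]addrC big1 ?add0r => [|m ml]; last first.
    by rewrite mxE (negPf ml) andbF mul0r.
  rewrite big1 ?addr0// => m mk; rewrite mxE big1// => m' _.
  by rewrite mxE (negPf mk) mul0r.
by rewrite !h.
Qed.

Lemma mul_delta_mul G (i j k l : 'I_n) : (G *m delta_mx i j *m G) k l = G k i * G j l.
Proof.
rewrite mxE (bigD1 j)//= big1 ?addr0 => [|m mj]; last first.
  rewrite mxE big1 ?mul0r// => m' _; rewrite mxE (negPf mj) andbF mulr0//.
congr (_ * _); rewrite mxE (bigD1 i)//= big1 ?addr0 => [|m mi].
  by rewrite mxE !eqxx mulr1.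
by rewrite mxE (negPf mi) mulr0.
Qed.

(** At position (j, i), the E_ij half of G (E_ij + E_ji) G is G_ji G_ji, which sums to tr G^2 by
    symmetry, and the E_ji half is G_jj G_ii, which sums to (tr G)^2. In the derivative of the
    monomial each of the two halves contributes tr (G G^{l+2}), whence the factor 2. *)
Lemma stein_sum K G : G^T = G ->
  \sum_i \sum_j (- (G *m (delta_mx i j + delta_mx j i) *m G) j i * gmono K G +
     G j i * gmono_diff K G (delta_mx i j + delta_mx j i)) =
  - (\tr (G ^+ 2) + \tr G ^+ 2) * gmono K G -
  2%:R * \sum_(l < size K) (nth 0%N K l)%:R *
    (npowC n (- (2 * l.+1%:R / 3)) * (l.+1%:R * \tr (G ^+ l.+3))) * gmono_drop K G l.
Proof.
move=> sG; have sGE i j : G i j = G j i by rewrite -{1}sG mxE.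
have trM (N : 'M[R[i]]_n) : \sum_i \sum_j G j i * N i j = \tr (G *m N).
  rewrite exchange_big; apply: eq_bigr => j _.
  by rewrite mxE; apply: eq_bigr => i _.
under eq_bigr do rewrite big_split/=.
rewrite big_split/=; congr (_ + _).
  under eq_bigr do rewrite -mulr_suml.
  rewrite -mulr_suml; congr (_ * _); rewrite opprD.
  under eq_bigr => i _ do under eq_bigr => j _ do
    rewrite mulmxDr mulmxDl mxE !mul_delta_mul opprD.
  under eq_bigr do rewrite big_split/=.
  rewrite big_split/=; congr (_ + _).
    rewrite -trM -sumrN; apply: eq_bigr => i _; rewrite -sumrN.
    by apply: eq_bigr => j _; rewrite [G i j]sGE.
  rewrite expr2 mulr_suml -sumrN; apply: eq_bigr => i _.
  by rewrite mulr_sumr -sumrN; apply: eq_bigr => j _; rewrite mulrC.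
rewrite mulr_sumr -sumrN.
under eq_bigr => i _ do under eq_bigr => j _ do rewrite mulr_sumr.
under eq_bigr => i _ do rewrite exchange_big/=.
rewrite exchange_big/=; apply: eq_bigr => l _.
rewrite [G ^+ l.+3]exprS -mulmxE.
have trM' (N : 'M[R[i]]_n) : \sum_i \sum_j G j i * N j i = \tr (G *m N).
  rewrite -trM exchange_big; apply: eq_bigr => j _.
  by apply: eq_bigr => i _; rewrite sGE.
set c := npowC _ _; set N := G ^+ _; set D := gmono_drop _ _ _.
transitivity (\sum_i \sum_j - ((nth 0%N K l)%:R * (c * l.+1%:R) * D) *
   (G j i * N j i + G j i * N i j)).
  apply: eq_bigr => i _; apply: eq_bigr => j _; rewrite trace_delta_mul; ring.
under eq_bigr => i _ do rewrite -mulr_sumr big_split/=.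
rewrite -mulr_sumr big_split/= trM' trM; ring.
Qed.

End moment_monomials.

Section gmono_analysis.
Context (R : realType) (n : nat).

Lemma glE (G : 'M[R[i]]_n) l : gl G l.+1 = npowC n (- (2 * l.+1%:R / 3)) *
  ((if l == 0%N then n%:R else 0) + \tr (G ^+ l.+1)).
Proof.
rewrite /gl; case: l => [|l]; first by rewrite eqxx mulr1 expr1.
by rewrite -[_ == 1%N]/false -[_ == 0%N]/false add0r.
Qed.

Lemma cbounded_gl d (U : measurableType d) (G : U -> 'M[R[i]]_n) l :
  mxbounded G -> cbounded (fun u => gl (G u) l.+1).
Proof.
move=> bG; under eq_fun do rewrite glE.
apply: cboundedM; first exact: cbounded_cst.
apply: cboundedD; first exact: cbounded_cst.
exact/cbounded_trace/mxboundedX.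
Qed.

Lemma cbounded_gmono d (U : measurableType d) (G : U -> 'M[R[i]]_n) K :
  mxbounded G -> cbounded (fun u => gmono K (G u)).
Proof. by move=> bG; apply: cbounded_prod => i; exact/cboundedX/cbounded_gl. Qed.

Lemma cbounded_gmono_drop d (U : measurableType d) (G : U -> 'M[R[i]]_n) K l :
  mxbounded G -> cbounded (fun u => gmono_drop K (G u) l).
Proof. by move=> bG; apply: cbounded_prod => i; exact/cboundedX/cbounded_gl. Qed.

Lemma cbounded_gmono_diff d (U : measurableType d) (G : U -> 'M[R[i]]_n) K X :
  mxbounded G -> cbounded (fun u => gmono_diff K (G u) X).
Proof.
move=> bG; apply: cbounded_sum => l; apply: cboundedM; last exact: cbounded_gmono_drop.
apply: cboundedM; first exact: cbounded_cst.
apply: cboundedM; first exact: cbounded_cst.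
apply: cboundedM; first exact: cbounded_cst.
under eq_fun do rewrite -mulN1r.
apply: cboundedM; first exact: cbounded_cst.
by apply: cbounded_trace; apply: mxbounded_mul;
  [exact: mxbounded_cst|exact: mxboundedX].
Qed.

Lemma gmono_cdiff d (W : measurableType d) (S : R * W -> 'M[R[i]]_n) K
    (X : 'M[R[i]]_n) : mxdiff S (fun p => - (S p *m X *m S p)) ->
  cdiff (fun p => gmono K (S p)) (fun p => gmono_diff K (S p) X).
Proof.
move=> dS.
have dgl l : cdiff (fun p => gl (S p) l.+1) (fun p => npowC n (- (2 * l.+1%:R / 3)) *
    (l.+1%:R * - \tr (X *m S p ^+ l.+2))).
  under eq_fun do rewrite glE.
  have dt := mxdiff_trace (mxdiffX l.+1 dS).
  apply: cdiff_ext (cdiffZ _ (cdiffD (cdiff_cst _ _) dt)) _ => p.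
  rewrite add0r -[mxdiff_pow _ _ _ _]mulmx1 trace_mxdiff_pow ?mulmx1 ?mul1mx//.
  congr (_ * (_ * _)); rewrite mulNmx linearN/= -!mulmxA mxtrace_mulC -mulmxA.
  by rewrite mulmxE -exprS -exprSr.
exact: cdiff_ext (cdiff_prod _ (fun i => dgl i)) _.
Qed.

End gmono_analysis.

(** * The exact identity for the GOE *)

Section GOE_identity.
Context d (T : measurableType d) (R : realType) (P : probability T R).
Variable a : nat -> nat -> {RV P >-> R}.
Hypothesis goe : GOE_family a.
Variables (n : nat) (z : R[i]) (K : seq nat).
Hypothesis n0 : (0 < n)%N.
Hypothesis z_im : complex.Im z != 0.

Local Notation om := (2%:R + z * npowC n (- (2 / 3))).
Local Notation G := (fun w => resolvent om (GOEmx a n w)).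

Let npow_gt0 (r : R) : 0 < (n%:R : R) `^ r.
Proof. by rewrite powR_gt0// ltr0n. Qed.

Let om_im : complex.Im om != 0.
Proof.
have im2 : complex.Im (2%:R : R[i]) = 0 by rewrite -[2%:R]/(1 + 1) cImD/= addr0.
by rewrite cImD im2 add0r cImM/= mulr0 add0r mulf_neq0// gt_eqF.
Qed.

Let symA w : (GOEmx a n w)^T = GOEmx a n w.
Proof. by apply/matrixP => i j; rewrite !mxE; case: goe => ->. Qed.

Let bG : mxbounded G.
Proof.
apply: mxbounded_resolvent => // i j.
under eq_fun do rewrite mxE; exact: measurable_funM.
Qed.

Let symG w : (G w)^T = G w.
Proof. exact: tr_resolvent. Qed.

Section entry.
Variables (i j : 'I_n).
Hypothesis ij : (i <= j)%N.

Let s := [seq p <- [seq (k, l) | k <- iota 0 n, l <- iota 0 n]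
  | (p.1 <= p.2)%N && (p != (i : nat, j : nat))].

Let W := g_sigma_algebraType (entry_system a s).

(* The GOE matrix with the entries [(i, j)] and [(j, i)] replaced by the free
   variable [p.1], over the sigma-algebra of all the other entries. *)
Let H (p : R * W) : 'M[R]_n := \matrix_(k, l)
  ((if (minn k l, maxn k l) == (i : nat, j : nat) then p.1
    else a (minn k l) (maxn k l) p.2) / Num.sqrt n%:R).

Let E : 'M[R]_n := \matrix_(k, l)
  (((minn k l, maxn k l) == (i : nat, j : nat))%:R / Num.sqrt n%:R).

Let symH p : (H p)^T = H p.
Proof. by apply/matrixP => k l; rewrite !mxE minnC maxnC. Qed.

Let subH x y w : H (y, w) - H (x, w) = (y - x) *: E.
Proof.
apply/matrixP => k l; rewrite !mxE/=; case: eqP => _ /=.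
  by rewrite mul1r mulrBl.
by rewrite mul0r mulr0 subrr.
Qed.

Let measurableH k l : measurable_fun setT (fun p => H p k l).
Proof.
under eq_fun do rewrite mxE; apply: measurable_funM => //.
case: eqP => [_|kl]; first exact: measurable_fst.
have ms : (minn k l, maxn k l) \in s.
  rewrite mem_filter/= (leq_trans (geq_minl _ _) (leq_maxl _ _)) andTb.
  apply/andP; split; first exact/eqP.
  by apply: allpairs_f; rewrite mem_iota/= add0n ?gtn_min ?gtn_max !ltn_ord.
exact: measurableT_comp (@measurable_entry_system _ _ _ P a s _ ms) measurable_snd.
Qed.

Let H_GOE w : H (a i j w, w) = GOEmx a n w.
Proof.
have sa k l : a k l w = a l k w by case: goe => ->.
apply/matrixP => k l; rewrite !mxE/=; congr (_ / _).
by case: (leqP k l) => kl; case: eqP => [[-> ->]|_].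
Qed.

(** On the diagonal E_ij + E_ji counts the position twice and [E] only once; the variance is exactly
    the missing factor, so diagonal and off-diagonal entries obey one formula. *)
Let E_delta : (1 + (i == j)%:R) *: map_mx (real_complex R) E =
  (Num.sqrt n%:R)^-1%:C *: (delta_mx i j + delta_mx j i).
Proof.
apply/matrixP => k l; rewrite !mxE rmorphM rmorph_nat.
set b := (_, _) == _.
have e : ((1 + (i == j)) * b = ((k == i) && (l == j)) + ((k == j) && (l == i)))%N.
  by rewrite /b xpair_eqE -!val_eqE/=; move: ij; lia.
by rewrite mulrA mulrC -natrD -e natrM natrD.
Qed.

(** Derivative of G_kl times the monomial when the matrix moves in direction [X]. *)
Let D X (k l : 'I_n) w := - (G w *m X *m G w) k l * gmono K (G w) +
  G w k l * gmono_diff K (G w) X.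

Let cexpect_DZ c X k l : cexpect P (D (c *: X) k l) = c * cexpect P (D X k l).
Proof.
rewrite -cexpect_cstM; last first.
  apply/cbounded_integrable/cboundedD; apply: cboundedM.
  - under eq_fun do rewrite -mulN1r.
    apply: cboundedM; first exact: cbounded_cst.
    have bGX : mxbounded (fun w => G w *m X).
      by apply: mxbounded_mul => //; exact: mxbounded_cst.
    have bGXG : mxbounded (fun w => G w *m X *m G w) by exact: mxbounded_mul.
    exact: bGXG.
  - exact: cbounded_gmono.
  - exact: bG.
  - exact: cbounded_gmono_diff.
congr cexpect; apply/funext => w; rewrite /D -scalemxAr -scalemxAl [X in - X]mxE.
rewrite /gmono_diff.
under eq_bigr do rewrite -scalemxAl mxtraceZ.
rewrite mulrDr; congr (_ + _); first by rewrite !mulNr mulrN mulrA.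
rewrite mulrCA; congr (_ * _); rewrite mulr_sumr; apply: eq_bigr => m _.
ring.
Qed.

Lemma entry_stein (k l : 'I_n) :
  cexpect P (fun w => (a i j w)%:C * (G w k l * gmono K (G w))) =
  (Num.sqrt n%:R)^-1%:C * cexpect P (D (delta_mx i j + delta_mx j i) k l).
Proof.
rewrite -cexpect_DZ -E_delta cexpect_DZ.
have dS := mxdiff_resolvent om_im symH measurableH subH.
have us : uniq ((i : nat, j : nat) :: s).
  rewrite /= mem_filter eqxx andbF/= filter_uniq//.
  by apply: allpairs_uniq; rewrite ?iota_uniq// => -[? ?] [? ?].
have ls : all (fun p => p.1 <= p.2)%N ((i : nat, j : nat) :: s).
  by rewrite /= ij; apply/allP => p; rewrite mem_filter => /andP[/andP[]].
pose F p := resolvent om (H p) k l * gmono K (resolvent om (H p)).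
pose F' p := (- (resolvent om (H p) *m map_mx (real_complex R) E *m
    resolvent om (H p))) k l * gmono K (resolvent om (H p)) +
  resolvent om (H p) k l *
    gmono_diff K (resolvent om (H p)) (map_mx (real_complex R) E).
have dF : cdiff F F' := cdiffM (dS k l) (gmono_cdiff K dS).
have FE w : F (a i j w, w) = G w k l * gmono K (G w).
  exact: (congr1 (fun M : 'M[R]_n => resolvent om M k l * gmono K (resolvent om M))
    (H_GOE w)).
have F'E w : F' (a i j w, w) = D (map_mx (real_complex R) E) k l w.
  apply: etrans (congr1 (fun M : 'M[R]_n => (- (resolvent om M *m
    map_mx (real_complex R) E *m resolvent om M)) k l * gmono K (resolvent om M) +
    resolvent om M k l * gmono_diff K (resolvent om M) (map_mx (real_complex R) E))
    (H_GOE w)) _.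
  by congr (_ * _ + _); rewrite [LHS]mxE.
have st := GOE_stein goe us ls dF.
move: F F' dF FE F'E st => F F' _ FE F'E st.
rewrite (_ : (fun w => _) = fun w => (a i j w)%:C * F (a i j w, w)); last first.
  by apply/funext => w; rewrite FE.
rewrite st; congr (_ * _); apply: (congr1 (cexpect P)); apply/funext => w.
exact: F'E.
Qed.
End entry.

(** Independence is stated for the upper triangle only; both sides are symmetric in [i] and [j]. *)
Lemma entry_stein_sym (i j k l : 'I_n) :
  cexpect P (fun w => (a i j w)%:C * (G w k l * gmono K (G w))) =
  (Num.sqrt n%:R)^-1%:C * cexpect P (fun w =>
    - (G w *m (delta_mx i j + delta_mx j i) *m G w) k l * gmono K (G w) +
    G w k l * gmono_diff K (G w) (delta_mx i j + delta_mx j i)).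
Proof.
have [ij|/ltnW ji] := leqP i j; first exact: entry_stein.
rewrite [delta_mx i j + _]addrC -(entry_stein ji).
apply: (congr1 (cexpect P)); apply/funext => w.
by case: goe => -> _ _.
Qed.

Let trace_AG w : \sum_(i < n) \sum_(j < n) (a i j w)%:C * G w j i =
  (Num.sqrt n%:R)%:C * (n%:R + om * \tr (G w)).
Proof.
have AG : map_mx (real_complex R) (GOEmx a n w) *m G w = 1%:M + om *: G w.
  have := mul_resolvent om_im (symA w).
  by rewrite mulmxBl mul_scalar_mx => /eqP; rewrite subr_eq => /eqP.
have -> : n%:R + om * \tr (G w) = \tr (map_mx (real_complex R) (GOEmx a n w) *m G w).
  by rewrite AG mxtraceD mxtrace1 mxtraceZ.
rewrite mulr_sumr; apply: eq_bigr => i _.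
rewrite mxE mulr_sumr; apply: eq_bigr => j _.
rewrite 2!mxE mulrA -rmorphM [_ * (_ / _)]mulrC divfK// gt_eqF// sqrtr_gt0 ltr0n//.
Qed.

Let bgl l : cbounded (fun w => gl (G w) l.+1).
Proof. exact: cbounded_gl. Qed.

Let bF : cbounded (fun w => gmono K (G w)).
Proof. exact: cbounded_gmono. Qed.

Let stein_rhs w := - (\tr (G w ^+ 2) + \tr (G w) ^+ 2) * gmono K (G w) -
  2%:R * \sum_(l < size K) (nth 0%N K l)%:R *
    (npowC n (- (2 * l.+1%:R / 3)) * (l.+1%:R * \tr (G w ^+ l.+3))) *
    gmono_drop K (G w) l.

(** The factor n is a product of two square roots: one converts the entries of A_n into the a_ij,
    the other cancels the n^{-1/2} of the derivative. *)
Let expect_AG : n%:R * cexpect P (fun w => (n%:R + om * \tr (G w)) * gmono K (G w)) =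
  cexpect P stein_rhs.
Proof.
have bD (i j k l : 'I_n) : cbounded (fun w =>
    - (G w *m (delta_mx i j + delta_mx j i) *m G w) k l * gmono K (G w) +
    G w k l * gmono_diff K (G w) (delta_mx i j + delta_mx j i)).
  apply: cboundedD; apply: cboundedM => //; last exact: cbounded_gmono_diff.
  have bGX : mxbounded (fun w => G w *m (delta_mx i j + delta_mx j i)).
    by apply: mxbounded_mul => //; exact: mxbounded_cst.
  have bGXG : mxbounded (fun w => G w *m (delta_mx i j + delta_mx j i) *m G w).
    exact: mxbounded_mul.
  exact: cboundedN.
have bt : cbounded (fun w => (n%:R + om * \tr (G w)) * gmono K (G w)).
  apply: cboundedM => //; apply: cboundedD; first exact: cbounded_cst.
  by apply: cboundedM; [exact: cbounded_cst|exact: cbounded_trace].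
have sn0 : (Num.sqrt n%:R)%:C != 0 :> R[i].
  by rewrite eq_complex/= gt_eqF// sqrtr_gt0 ltr0n.
have eL : (Num.sqrt n%:R)%:C *
    cexpect P (fun w => (n%:R + om * \tr (G w)) * gmono K (G w)) =
    \sum_(p : 'I_n * 'I_n)
      cexpect P (fun w => (a p.1 p.2 w)%:C * (G w p.2 p.1 * gmono K (G w))).
  rewrite -cexpect_cstM; last exact: cbounded_integrable.
  rewrite -cexpect_sum; last first.
    move=> p; apply: cintegrableM_bounded; first exact: integrable_GOE_entry goe _ _.
    by apply: cboundedM => //; exact: bG.
  apply: (congr1 (cexpect P)); apply/funext => w.
  rewrite mulrA -trace_AG pair_big/= mulr_suml; apply: eq_bigr => p _.
  by rewrite mulrA.
have eR : cexpect P stein_rhs = \sum_(p : 'I_n * 'I_n) cexpect P (fun w =>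
    - (G w *m (delta_mx p.1 p.2 + delta_mx p.2 p.1) *m G w) p.2 p.1 * gmono K (G w) +
    G w p.2 p.1 * gmono_diff K (G w) (delta_mx p.1 p.2 + delta_mx p.2 p.1)).
  rewrite -cexpect_sum; last by move=> p; exact: cbounded_integrable.
  apply: (congr1 (cexpect P)); apply/funext => w.
  by rewrite /stein_rhs -(stein_sum K (symG w)) pair_big.
have nE : n%:R = (Num.sqrt n%:R)%:C * (Num.sqrt n%:R)%:C :> R[i].
  by rewrite -rmorphM -expr2 sqr_sqrtr ?ler0n// rmorph_nat.
rewrite [X in X * _ = _]nE -mulrA eL eR.
under eq_bigr do rewrite entry_stein_sym.
by rewrite -mulr_sumr mulrA -rmorphM divff ?mul1r// gt_eqF// sqrtr_gt0 ltr0n.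
Qed.

(** Every power of n becomes a power of n^{-1/3}, which reduces the final cancellation to a rational
    identity. *)
Let npowCE k : npowC n (- (2 * k%:R / 3)) = npowC n (- (1 / 3)) ^+ (2 * k) :> R[i].
Proof.
rewrite /npowC -rmorphXn -powR_mulrn ?powR_ge0// -powRrM natrM.
by congr ((_ `^ _)%:C); field.
Qed.

Let npowC_cube : n%:R * npowC n (- (1 / 3)) ^+ 3 = 1 :> R[i].
Proof.
rewrite /npowC -rmorphXn -powR_mulrn ?powR_ge0// -powRrM.
rewrite (_ : _ * 3%:R = -1 :> R); last by field.
by rewrite powR_inv1// -(rmorph_nat (real_complex R)) -rmorphM divff// pnatr_eq0 -lt0n.
Qed.

Lemma core_identity :
  z * cexpect P (fun w => gmono K (G w)) -
  cexpect P (fun w => gmono K (G w) * gl (G w) 1 ^+ 2) -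
  cexpect P (fun w => gmono K (G w) * gl (G w) 2) -
  2%:R * \sum_(l < size K) (l.+1 * nth 0%N K l)%:R *
    cexpect P (fun w => gmono_drop K (G w) l * gl (G w) l.+3) =
  z * npowC n (- (1 / 3)) * cexpect P (fun w => gmono K (G w) * gl (G w) 1).
Proof.
set v : R[i] := npowC n (- (1 / 3)).
have v0 : v != 0 by rewrite eq_complex/= gt_eqF.
have nv : n%:R = v ^- 3.
  by apply/(mulIf (expf_neq0 3 v0)); rewrite npowC_cube mulVf ?expf_neq0.
have v2 : npowC n (- (2 / 3)) = v ^+ 2 by have := npowCE 1; rewrite mulr1 muln1.
have bd l : cbounded (fun w => gmono_drop K (G w) l * gl (G w) l.+3).
  by apply: cboundedM => //; exact: cbounded_gmono_drop.
have b1 : cbounded (fun w => gmono K (G w) * gl (G w) 1 ^+ 2).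
  by apply: cboundedM => //; exact: cboundedX.
have b2 : cbounded (fun w => gmono K (G w) * gl (G w) 2) by exact: cboundedM.
have b3 : cbounded (fun w => gmono K (G w) * gl (G w) 1) by exact: cboundedM.
have bt : cbounded (fun w => (n%:R + om * \tr (G w)) * gmono K (G w)).
  apply: cboundedM => //; apply: cboundedD; first exact: cbounded_cst.
  by apply: cboundedM; [exact: cbounded_cst|exact: cbounded_trace].
have bS : cbounded (fun w => \sum_(l < size K) (l.+1 * nth 0%N K l)%:R *
    (gmono_drop K (G w) l * gl (G w) l.+3)).
  by apply: cbounded_sum => l; apply: cboundedM => //; exact: cbounded_cst.
pose Psi w := z * gmono K (G w) - gmono K (G w) * gl (G w) 1 ^+ 2 -
  gmono K (G w) * gl (G w) 2 -
  2%:R * \sum_(l < size K) (l.+1 * nth 0%N K l)%:R *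
    (gmono_drop K (G w) l * gl (G w) l.+3) -
  z * v * (gmono K (G w) * gl (G w) 1).
have bc c f : cbounded f -> cbounded (fun w : T => c * f w : R[i]).
  by move=> bf; apply: cboundedM => //; exact: cbounded_cst.
have bB f g : cbounded f -> cbounded g -> cbounded (fun w : T => f w - g w : R[i]).
  by move=> bf bg; apply: cboundedD => //; exact: cboundedN.
have EPsi : cexpect P Psi = z * cexpect P (fun w => gmono K (G w)) -
  cexpect P (fun w => gmono K (G w) * gl (G w) 1 ^+ 2) -
  cexpect P (fun w => gmono K (G w) * gl (G w) 2) -
  2%:R * \sum_(l < size K) (l.+1 * nth 0%N K l)%:R *
    cexpect P (fun w => gmono_drop K (G w) l * gl (G w) l.+3) -
  z * v * cexpect P (fun w => gmono K (G w) * gl (G w) 1).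
  have c1 := bc z _ bF; have c2 := bB _ _ c1 b1; have c3 := bB _ _ c2 b2.
  have c4 := bc 2%:R _ bS; have c5 := bB _ _ c3 c4; have c6 := bc (z * v) _ b3.
  rewrite [LHS](cexpectB P c5 c6) [X in X - _](cexpectB P c3 c4).
  rewrite [X in X - _ - _](cexpectB P c2 b2) [X in X - _ - _ - _](cexpectB P c1 b1).
  rewrite (cexpect_cstM _ (cbounded_integrable P bF)).
  rewrite (cexpect_cstM _ (cbounded_integrable P bS)).
  rewrite (cexpect_cstM _ (cbounded_integrable P b3)).
  congr (_ - _ * _ - _); rewrite cexpect_sum; last first.
    by move=> l; apply/cbounded_integrable/bc.
  apply: eq_bigr => l _.
  by rewrite (cexpect_cstM _ (cbounded_integrable P (bd l))).
apply/eqP; rewrite -subr_eq0 -EPsi; apply/eqP.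
(* The difference of the two sides is a multiple of the integration by parts defect already before
   taking expectations. The factor v^4 is the weight of g_2 and of the square of g^c_1, and the
   weight 2(l + 3) of [gl _ l.+3] splits as 4 + 2(l + 1). *)
have PsiE w : Psi w = v ^+ 4 *
  (stein_rhs w - n%:R * ((n%:R + om * \tr (G w)) * gmono K (G w))).
  rewrite /Psi /stein_rhs.
  pose S := \sum_(l < size K) (l.+1 * nth 0%N K l)%:R *
    (gmono_drop K (G w) l * (v ^+ (2 * l.+1) * \tr (G w ^+ l.+3))).
  have -> : \sum_(l < size K) (l.+1 * nth 0%N K l)%:R *
      (gmono_drop K (G w) l * gl (G w) l.+3) = v ^+ 4 * S.
    rewrite mulr_sumr; apply: eq_bigr => l _.
    by rewrite glE add0r npowCE (_ : (2 * l.+3 = 4 + 2 * l.+1)%N) ?exprD; [ring|lia].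
  have -> : \sum_(l < size K) (nth 0%N K l)%:R *
      (npowC n (- (2 * l.+1%:R / 3)) * (l.+1%:R * \tr (G w ^+ l.+3))) *
      gmono_drop K (G w) l = S.
    by apply: eq_bigr => l _; rewrite npowCE natrM; ring.
  rewrite !glE !eqxx/= add0r expr1 !npowCE -/v v2 nv muln1.
  move: S (gmono _ _) (\tr (G w)) (\tr (G w ^+ 2)) => S F t t2.
  by field.
have bs : cbounded stein_rhs.
  apply: bB; first apply: cboundedM => //.
    apply: cboundedN; apply: cboundedD; last exact/cboundedX/cbounded_trace.
    exact/cbounded_trace/mxboundedX.
  apply: (bc 2%:R); apply: cbounded_sum => l.
  apply: cboundedM; last exact: cbounded_gmono_drop.
  apply: (bc _ (fun w => npowC n (- (2 * l.+1%:R / 3)) * (l.+1%:R * \tr (G w ^+ l.+3)))).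
  apply: (bc _ (fun w => l.+1%:R * \tr (G w ^+ l.+3))).
  apply: (bc _ (fun w => \tr (G w ^+ l.+3))).
  exact/cbounded_trace/mxboundedX.
rewrite (_ : Psi = fun w => v ^+ 4 *
  (stein_rhs w - n%:R * ((n%:R + om * \tr (G w)) * gmono K (G w)))); last exact/funext.
rewrite cexpect_cstM; last by apply/cbounded_integrable/bB => //; exact: bc.
rewrite cexpectB//; last exact: bc.
rewrite cexpect_cstM; last exact: cbounded_integrable.
by rewrite expect_AG subrr mulr0.
Qed.

End GOE_identity.

(** * From the exact identity to the asymptotic statement *)

Lemma bigO_pow_zero (R : realType) (r : R) : bigO_pow (fun=> 0) r.
Proof. by exists 0, 0%N => n _; rewrite normr0 mul0r. Qed.

Lemma bigO_pow_npowC (R : realType) (c : R[i]) (r : R) :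
  bigO_pow (fun n => c * npowC n r) r.
Proof.
exists (complex.Re `|c|), 0%N => n _.
apply: normM_real_le; first by rewrite RRe_real ?normr_real.
by rewrite norm_real_complex ger0_norm// powR_ge0.
Qed.

Lemma loop_equation (R : realType) (d : measure_display) (T : measurableType d)
    (P : probability T R) (a : nat -> nat -> {RV P >-> R}) (z : R[i]) (K : seq nat) n :
  GOE_family a -> complex.Im z != 0 -> (0 < n)%N ->
  mK a n z K * z
    - mK a n z (madd (madd K (unitmi 1)) (unitmi 1))
    - mK a n z (madd K (unitmi 2))
    - 2%:R * \sum_(1 <= l < (size K).+1)
        (l * mcomp K l)%:R * mK a n z (madd (msub K (unitmi l)) (unitmi l.+2))
  = z * npowC n (- (1 / 3)) * mK a n z (madd K (unitmi 1)).
Proof.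
move=> goe z0 n0; have core := core_identity goe K n0 z0.
have mKE L : mK a n z L =
  cexpect P (fun w => gmono L
    (resolvent (2%:R + z * npowC n (- (2 / 3))) (GOEmx a n w))) by [].
have mE L (f : 'M[R[i]]_n -> R[i]) : gmono L =1 f -> mK a n z L =
  cexpect P (fun w => f (resolvent (2%:R + z * npowC n (- (2 / 3))) (GOEmx a n w))).
  by move=> Lf; rewrite mKE; apply: (congr1 (cexpect P)); apply/funext => w.
rewrite (mE (madd (madd K _) _) (fun G => gmono K G * gl G 1 ^+ 2)); last first.
  by move=> G; rewrite !gmono_madd !gmono_unitmi expr2 mulrA.
rewrite (mE (madd K (unitmi 2)) (fun G => gmono K G * gl G 2)); last first.
  by move=> G; rewrite gmono_madd gmono_unitmi.
rewrite (mE (madd K (unitmi 1)) (fun G => gmono K G * gl G 1)); last first.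
  by move=> G; rewrite gmono_madd gmono_unitmi.
rewrite -core mKE [_ * z]mulrC; congr (_ - _ * _).
(* The sum is shifted to start at 0; [l] then ranges below [size K], where [gmono_msub] identifies K
   - e_{l+1}. *)
rewrite big_add1/= big_mkord; apply: eq_bigr => l _; congr (_ * _).
rewrite (mE _ (fun G => gmono_drop K G l * gl G l.+3))// => G.
by rewrite gmono_madd gmono_unitmi gmono_msub.
Qed.

Theorem theorem1p1 (R : realType) (d : measure_display) (T : measurableType d)
  (P : probability T R) (a : nat -> nat -> {RV P >-> R}) :
  GOE_family a ->
  forall z : R[i], complex.Im z != 0 ->
  (forall K : seq nat, mi_nonzero K ->
    exists (c0 c1 c2 c4 : nat -> R[i]) (c3 : nat -> nat -> R[i]),
      [/\ bigO_pow c0 (- (2 / 3)), bigO_pow c1 (- (2 / 3)),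
          bigO_pow c2 (- (2 / 3)),
          (forall l, bigO_pow (c3 l) (- (2 / 3))) /\ bigO_pow c4 (- (1 / 3)) &
      exists N : nat, forall n : nat, (N <= n)%N ->
        mK a n z K * (z + c0 n)
        - mK a n z (madd (madd K (unitmi 1)) (unitmi 1)) * (1 + c1 n)
        - mK a n z (madd K (unitmi 2)) * (1 + c2 n)
        - 2%:R * \sum_(1 <= l < (size K).+1)
              (l * mcomp K l)%:R
              * mK a n z (madd (msub K (unitmi l)) (unitmi l.+2)) * (1 + c3 l n)
        = c4 n * mK a n z (madd K (unitmi 1))])
  /\
  (exists (c0 c1 c2 c4 : nat -> R[i]),
      [/\ bigO_pow c0 (- (2 / 3)), bigO_pow c1 (- (2 / 3)),
          bigO_pow c2 (- (2 / 3)), bigO_pow c4 (- (1 / 3)) &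
      exists N : nat, forall n : nat, (N <= n)%N ->
        z + c0 n
        - mK a n z (madd (unitmi 1) (unitmi 1)) * (1 + c1 n)
        - mK a n z (unitmi 2) * (1 + c2 n)
        = c4 n * mK a n z (unitmi 1)]).
Proof.
move=> goe z z_im; split=> [K _|].
  exists (fun=> 0), (fun=> 0), (fun=> 0), (fun n => z * npowC n (- (1 / 3))),
    (fun _ _ => 0).
  split; [exact: bigO_pow_zero..|split|].
  - by move=> l; exact: bigO_pow_zero.
  - exact: bigO_pow_npowC.
  (* The value n = 0 is excluded, as n v^3 = 1 fails there. *)
  - exists 1%N => n n0; rewrite -loop_equation// !addr0 !mulr1.
    by under eq_bigr do rewrite mulr1.
exists (fun=> 0), (fun=> 0), (fun=> 0), (fun n => z * npowC n (- (1 / 3))).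
split; [exact: bigO_pow_zero..|exact: bigO_pow_npowC|].
(* The boundary condition is the identity for the empty multi-index: its monomial is the empty
   product, with expectation 1, and its sum over [l] is empty. *)
exists 1%N => n n0; have := loop_equation [::] goe z_im n0.
have -> : mK a n z [::] = 1.
  transitivity (cexpect P (fun=> 1 : R[i])).
    by apply: (congr1 (cexpect P)); apply/funext => w; rewrite big_ord0.
  by rewrite cexpectE !Rintegral_cst//= probability_setT/= !mulr1.
rewrite big_geq// mulr0 subr0 mul1r !addr0 !mulr1.
by [].
Qed.
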